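(* Let $d\ge2$, $q\in[1,+\infty)$, and let $\mathcal X$ and $\mathcal Y$ be compact and convex subsets of $\mathbb R^d$. Let $M>0$, $\theta\in(0,1]$, let $\rho$ be a probability measure on $\mathcal X$ satisfying $\rho(B_\eta(x))\le M\eta^{d-1+\theta}$ for every $x\in\mathbb R^d$ and $\eta>0$, and let $\mu\in\mathcal P(\mathcal Y)$. Then for every $\psi\in\mathcal C^0(\mathcal Y)$, $$\|\nabla\psi^*-T_{\rho\to\mu}\|_{L^q(\rho)}^q\le C\left(\mathcal K_{\rho,\mu}(\psi)-\min_{\mathcal C^0(\mathcal Y)}\mathcal K_{\rho,\mu}\right)^{\frac{\theta}{1+\theta}},$$ where $C=D_{\mathcal Y}^{\,q}\left(1+c_dMD_{\mathcal X}^{d-1+\theta}\right)(D_{\mathcal Y}D_{\mathcal X})^{-\frac{\theta}{1+\theta}}$.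
   Context: $\mathcal P(E)$ is the set of Borel probability measures on $E$, $\mathcal C^0(\mathcal Y)$ the continuous real functions on $\mathcal Y$, and $B_\eta(x)$ the open Euclidean ball. $D_{\mathcal X}=\operatorname{diam}(\mathcal X)$, $D_{\mathcal Y}=\operatorname{diam}(\mathcal Y)$. $\beta_k$ is the volume of the unit ball of $\mathbb R^k$ and $c_d=\frac43\,\frac{6^d d^2(d+1)\beta_d}{\beta_{d-1}}$. For $\psi\in\mathcal C^0(\mathcal Y)$, $\psi^*(x)=\sup_{y\in\mathcal Y}\langle x,y\rangle-\psi(y)$ for $x\in\mathbb R^d$ (the Legendre transform of $\psi$ extended by $+\infty$ outside $\mathcal Y$), and $\mathcal K_{\rho,\mu}(\psi)=\int_{\mathcal X}\psi^*\,d\rho+\int_{\mathcal Y}\psi\,d\mu$. Under the condition on $\rho$, gradients of convex functions $\mathbb R^d\to\mathbb R$ are defined $\rho$-a.e., and (Brenier-McCann) the minimiser of $\int\|x-y\|^2\,d\gamma$ over couplings $\gamma$ of $\rho$ and $\mu$ is unique and induced by a map, denoted $T_{\rho\to\mu}$ (the optimal transport map). *)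

(* Defs.v *)
From HB Require Import structures.
From mathcomp Require Export all_boot all_order all_algebra.
From mathcomp Require Export all_classical all_reals all_analysis.
Export Order.TTheory GRing.Theory Num.Theory.
Export numFieldNormedType.Exports.

Set Implicit Arguments.
Unset Strict Implicit.
Unset Printing Implicit Defensive.

Local Open Scope classical_set_scope.
Local Open Scope ring_scope.

Section Euclidean.
Context {R : realType} {d : nat}.
Implicit Types (x y : 'rV[R]_d) (A : set 'rV[R]_d).

Definition dot x y : R := \sum_(i < d) x 0 i * y 0 i.

(* The norm [`|x|] that the library puts on ['rV[R]_d] is the sup norm; it
   induces the same topology, but balls and diameters have to be Euclidean. *)
Definition enorm x : R := Num.sqrt (dot x x).

Definition eball x (r : R) : set 'rV[R]_d := [set y | enorm (y - x) < r].

Definition diam A : R :=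
  sup [set r | exists x y, [/\ A x, A y & r = enorm (x - y)]].

(* Represents ['d f x] in the standard basis; a junk value where [f] is not
   differentiable. *)
Definition gradient (f : 'rV[R]_d -> R) x : 'rV[R]_d :=
  \row_i 'd f x (delta_mx 0 i).

End Euclidean.

(* The k-fold product of the Lebesgue measure of [R] (on Borel sets), written
   out by slicing along the first coordinate, as in the library's [\x]. *)
Fixpoint volume {R : realType} (k : nat) : set 'rV[R]_k -> \bar R :=
  match k return set 'rV[R]_k -> \bar R with
  | 0 => fun A => (\1_A 0)%:E
  | k'.+1 => fun A =>
      (\int[lebesgue_measure]_t
         volume [set x : 'rV[R]_k' | A (row_mx t%:M x : 'rV[R]_(1 + k'))])%E
  end.

Definition unit_ball_volume (R : realType) (k : nat) : R :=
  fine (volume (eball (0 : 'rV[R]_k) 1)).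

Definition c_const (R : realType) (d : nat) : R :=
  4 / 3 * (6 ^+ d * d%:R ^+ 2 * (d%:R + 1) * unit_ball_volume R d
           / unit_ball_volume R d.-1).

(* R^d with its Borel sigma-algebra. *)
Notation borelRV R d := (g_sigma_algebraType (@open 'rV[R]_d)).

Definition is_minimum {R : realType} {T : Type} (S : set T) (f : T -> R)
    (m : R) : Prop :=
  (exists2 s, S s & f s = m) /\ (forall s, S s -> m <= f s).

Section Kantorovich.
Context {R : realType} {d : nat}.
Implicit Types (X Y : set 'rV[R]_d) (psi : 'rV[R]_d -> R).
Implicit Types (rho mu : probability (borelRV R d) R).

(* Elements of C^0(Y) are represented by functions on the whole space, of which
   only the restriction to [Y] is ever used. *)
Definition C0 Y : set ('rV[R]_d -> R) := [set psi | {within Y, continuous psi}].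

Definition legendre Y psi (x : 'rV[R]_d) : R :=
  sup [set dot x y - psi y | y in Y].

Definition kantorovich X Y rho mu psi : R :=
  \int[rho]_(x in X) legendre Y psi x + \int[mu]_(y in Y) psi y.

Definition is_coupling rho mu
    (gamma : probability (borelRV R d * borelRV R d)%type R) : Prop :=
  forall A : set (borelRV R d), measurable A ->
    gamma (A `*` setT) = rho A /\ gamma (setT `*` A) = mu A.

Definition transport_cost
    (gamma : probability (borelRV R d * borelRV R d)%type R) : \bar R :=
  (\int[gamma]_z (enorm (z.1 - z.2 : 'rV[R]_d) ^+ 2)%:E)%E.

Definition is_optimal_coupling rho mu gamma : Prop :=
  is_coupling rho mu gamma /\
  forall gamma', is_coupling rho mu gamma' ->
    (transport_cost gamma <= transport_cost gamma')%E.

Definition is_optimal_map rho mu (T : borelRV R d -> borelRV R d) : Prop :=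
  measurable_fun setT T /\
  exists2 gamma, is_optimal_coupling rho mu gamma &
    forall B, measurable B -> gamma B = rho ((fun x => (x, T x)) @^-1` B).

Definition stability_const X Y (q M theta : R) : R :=
  diam Y `^ q * (1 + c_const R d * M * diam X `^ (d%:R - 1 + theta))
  * (diam Y * diam X) `^ (- (theta / (1 + theta))).

End Kantorovich.

(* Main.v *)
From HB Require Import structures.
Require Import Defs.
From mathcomp Require Import measurable_realfun ring lra.

(** Write [f] for [legendre Y psi], [D] and [L] for the diameters of [X] and [Y],
    and [eps] for the gap of the dual functional at [psi]. The function [f] is
    convex, and at every point it has a subgradient in [Y], so its slopes differ
    by at most [L].

    The pointwise estimate compares a subgradient [p] of [f] at [x] with the point
    [T x]. The latter is a subgradient up to the error [excess Y T psi x], the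
    defect in the Fenchel-Young inequality at [(x, T x)]. Following the direction
    of [T x - p] for a length [eta] gives
    [eta * enorm (T x - p) <= excess Y T psi x + second_diff f x (eta *: u)] for a
    unit vector [u] ([dist_subgradient_le]).

    Second differences are small on average. Near a point of a lattice of mesh
    comparable to [eta], those in all directions are controlled by those at the
    lattice point along the axes. Along a line of lattice points the latter
    telescope to a difference of slopes, hence sum to a multiple of [eta * L], and
    about [(D / eta) ^+ d.-1] lines meet [X]. A ball around a lattice point has
    mass at most [M * eta `^ (d - 1 + theta)], so [second_diff f x (eta *: u)] has,
    on [X], a majorant with integral at most
    [eta * (c_d * M * L * D ^+ d.-1 * eta `^ theta)] ([exists_covering_function]).
    That the constant [c_d] is large enough rests on a lower bound for the ratio of
    the volumes of consecutive unit balls ([unit_ball_volume_ratio]). The same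
    majorant, divided by [eta], tends to zero in mean with [eta], which makes [f]
    differentiable almost everywhere ([gradient_subgradient_ae]).

    The gap [eps] is the mean of the defect. Indeed the dual functional exceeds the
    integral of [dot x (T x)] by that mean ([integral_excess]), and some potential
    has no defect ([kantorovich_minimum]): the map [T] is cyclically monotone on a
    set of full measure, because a small mass exchanged cyclically around a
    violating cycle would lower the cost ([optimal_map_cyclic_monotone]), and
    Rockafellar's construction turns cyclic monotonicity into a potential.

    As [enorm (gradient f x - T x) <= L] almost everywhere, integrating the
    pointwise estimate bounds the [q]-th power of the norm by
    [L `^ (q - 1) * (eps / eta + c_d * M * L * D ^+ d.-1 * eta `^ theta)] for every
    [eta <= D], and a choice of [eta] gives the theorem ([optimise_scale]). *)

Set Implicit Arguments.
Unset Strict Implicit.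
Unset Printing Implicit Defensive.

Local Open Scope classical_set_scope.
Local Open Scope ring_scope.

(** * Euclidean geometry *)

Section EuclideanTheory.
Context {R : realType} {d : nat}.
Implicit Types (x y z u v : 'rV[R]_d) (a b t : R).

Lemma dotC x y : dot x y = dot y x.
Proof. by apply: eq_bigr => i _; rewrite mulrC. Qed.

Lemma dotDl x y z : dot (x + y) z = dot x z + dot y z.
Proof. by rewrite -big_split; apply: eq_bigr => i _; rewrite mxE mulrDl. Qed.

Lemma dotZl a x y : dot (a *: x) y = a * dot x y.
Proof. by rewrite /dot mulr_sumr; apply: eq_bigr => i _; rewrite mxE mulrA. Qed.

Lemma dotDr x y z : dot z (x + y) = dot z x + dot z y.
Proof. by rewrite !(dotC z) dotDl. Qed.

Lemma dotZr a x y : dot x (a *: y) = a * dot x y.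
Proof. by rewrite dotC dotZl dotC. Qed.

Lemma dotNl x y : dot (- x) y = - dot x y.
Proof. by rewrite -scaleN1r dotZl mulN1r. Qed.

Lemma dotNr x y : dot x (- y) = - dot x y.
Proof. by rewrite dotC dotNl dotC. Qed.

Lemma dotBl x y z : dot (x - y) z = dot x z - dot y z.
Proof. by rewrite dotDl dotNl. Qed.

Lemma dotBr x y z : dot z (x - y) = dot z x - dot z y.
Proof. by rewrite dotDr dotNr. Qed.

Lemma dot0l x : dot 0 x = 0.
Proof. by rewrite -(scale0r 0) dotZl mul0r. Qed.

Lemma dot0r x : dot x 0 = 0.
Proof. by rewrite dotC dot0l. Qed.

Lemma dot_suml (I : Type) (s : seq I) (F : I -> 'rV[R]_d) y :
  dot (\sum_(i <- s) F i) y = \sum_(i <- s) dot (F i) y.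
Proof.
elim: s => [|i s IH]; first by rewrite !big_nil dot0l.
by rewrite !big_cons dotDl IH.
Qed.

Lemma dot_delta x i : dot (delta_mx 0 i) x = x 0 i.
Proof.
rewrite /dot (bigD1 i)//= big1 => [|j ji]; rewrite !mxE !eqxx/= ?mul1r ?addr0//.
by rewrite (negPf ji) mul0r.
Qed.

Lemma dot_ge0 x : 0 <= dot x x.
Proof. by apply: sumr_ge0 => i _; rewrite -expr2 sqr_ge0. Qed.

Lemma enorm_ge0 x : 0 <= enorm x.
Proof. exact: sqrtr_ge0. Qed.

Lemma enorm_sqr x : enorm x ^+ 2 = dot x x.
Proof. exact: sqr_sqrtr (dot_ge0 x). Qed.

Lemma enormZ a x : enorm (a *: x) = `|a| * enorm x.
Proof.
by rewrite /enorm dotZl dotZr mulrA -expr2 sqrtrM ?sqr_ge0// sqrtr_sqr.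
Qed.

Lemma enormN x : enorm (- x) = enorm x.
Proof. by rewrite -scaleN1r enormZ normrN1 mul1r. Qed.

Lemma enormB x y : enorm (x - y) = enorm (y - x).
Proof. by rewrite -enormN opprB. Qed.

Lemma enorm0 : enorm (0 : 'rV[R]_d) = 0.
Proof. by rewrite /enorm dot0l sqrtr0. Qed.

Lemma enorm_eq0 x : enorm x = 0 -> x = 0.
Proof.
move=> x0; have : dot x x = 0 by rewrite -enorm_sqr x0 expr0n.
move=> /eqP; rewrite psumr_eq0 => [/allP xx|i _]; last by rewrite -expr2 sqr_ge0.
apply/rowP => i; rewrite mxE; apply/eqP.
by have := xx i (mem_index_enum i); rewrite mulf_eq0 orbb.
Qed.

Lemma coord_le_enorm x i : `|x 0 i| <= enorm x.
Proof.
rewrite -sqrtr_sqr ler_sqrt ?dot_ge0// /dot (bigD1 i)//= expr2 lerDl.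
by apply: sumr_ge0 => j _; rewrite -expr2 sqr_ge0.
Qed.

Lemma dot_le_enorm x y : dot x y <= enorm x * enorm y.
Proof.
have [/eqP x0|xn0] := boolP (enorm x == 0).
  by rewrite (enorm_eq0 x0) dot0l enorm0 mul0r.
have [/eqP y0|yn0] := boolP (enorm y == 0).
  by rewrite (enorm_eq0 y0) dot0r enorm0 mulr0.
have xp : 0 < enorm x by rewrite lt_def xn0 enorm_ge0.
have yp : 0 < enorm y by rewrite lt_def yn0 enorm_ge0.
have := dot_ge0 (enorm y *: x - enorm x *: y).
rewrite dotBl !dotBr !dotZl !dotZr -!enorm_sqr (dotC y x).
set a := enorm x; set b := enorm y; set c := dot x y => h.
have : 0 <= 2 * (a * b) * (a * b - c) by lra.
by rewrite pmulr_rge0 ?subr_ge0// !mulr_gt0.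
Qed.

Lemma enormD x y : enorm (x + y) <= enorm x + enorm y.
Proof.
rewrite -(ler_pXn2r (n := 2))// ?nnegrE ?addr_ge0 ?enorm_ge0//.
rewrite enorm_sqr dotDl !dotDr -!enorm_sqr (dotC y x) sqrrD.
by have := dot_le_enorm x y; lra.
Qed.

Lemma enorm_triangle z x y : enorm (x - y) <= enorm (x - z) + enorm (z - y).
Proof. by rewrite -[x - y](subrKA z); exact: enormD. Qed.

Lemma normr_dot_le x y : `|dot x y| <= enorm x * enorm y.
Proof.
rewrite ler_norml dot_le_enorm andbT lerNl -dotNl -(enormN x).
exact: dot_le_enorm.
Qed.

(** Cauchy-Schwarz against the indicator of [P]. *)
Lemma sum_abs_le_enorm (P : pred 'I_d) x :
  \sum_(i | P i) `|x 0 i| <= Num.sqrt #|P|%:R * enorm x.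
Proof.
pose s : 'rV[R]_d := \row_i (P i)%:R.
pose u : 'rV[R]_d := \row_i `|x 0 i|.
have -> : \sum_(i | P i) `|x 0 i| = dot s u.
  rewrite /dot big_mkcond; apply: eq_bigr => i _; rewrite !mxE.
  by case: (P i); rewrite ?mul1r ?mul0r.
have -> : enorm x = enorm u.
  congr Num.sqrt; apply: eq_bigr => i _; rewrite !mxE -normrM ger0_norm//.
  by rewrite -expr2 sqr_ge0.
have -> : Num.sqrt #|P|%:R = enorm s.
  congr Num.sqrt; rewrite /dot -sum1_card natr_sum [LHS]big_mkcond.
  by apply: eq_bigr => i _; rewrite !mxE -natrM unfold_in; case: (P i).
exact: dot_le_enorm.
Qed.

Lemma coord_le_sup_norm x i : `|x 0 i| <= `|x|.
Proof.
by rewrite [leRHS]/Num.norm/= mx_normrE; apply/bigmax_geP; right; exists (0, i).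
Qed.

Lemma enorm_le_sup_norm x : enorm x <= d%:R * `|x|.
Proof.
rewrite -(ler_pXn2r (n := 2))// ?nnegrE ?mulr_ge0 ?enorm_ge0// enorm_sqr.
have: dot x x <= \sum_(i < d) `|x| ^+ 2.
  apply: ler_sum => i _; rewrite -expr2 -real_normK ?num_real//.
  by rewrite lerXn2r ?nnegrE// coord_le_sup_norm.
move/le_trans; apply; rewrite sumr_const card_ord exprMn -[leLHS]mulr_natl.
rewrite ler_wpM2r ?sqr_ge0// expr2 -natrM ler_nat; by case: (d) => // k; rewrite leq_pmull.
Qed.

Lemma lipschitz_at_continuous x (f : 'rV[R]_d -> R) K :
  (forall y, `|f x - f y| <= K * enorm (x - y)) -> {for x, continuous f}.
Proof.
move=> fK; apply/(pseudometric_normed_Zmodule.cvgrPdist_lt (FF := nbhs_filter x)).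
move=> e e0; apply/nbhs_ballP.
have D0 : 0 < `|K| * d%:R + 1 by rewrite ltr_wpDl// mulr_ge0.
exists (e / (`|K| * d%:R + 1)) => /=; first by rewrite divr_gt0.
move=> y; rewrite -ball_normE/= ltr_pdivlMr// => xy.
apply: le_lt_trans (fK y) _; apply: le_lt_trans xy.
apply: (@le_trans _ _ (`|K| * (d%:R * `|x - y|))).
  apply: (@le_trans _ _ (`|K| * enorm (x - y))).
    by rewrite ler_wpM2r ?enorm_ge0 ?ler_norm.
  by rewrite ler_wpM2l ?enorm_le_sup_norm.
by rewrite mulrA mulrC ler_wpM2l// lerDl.
Qed.

Lemma normr_enormB_le x y : `|enorm x - enorm y| <= enorm (x - y).
Proof.
rewrite ler_norml; have := enormD (x - y) y; have := enormD (y - x) x.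
by rewrite !subrK (enormB y x); lra.
Qed.

Lemma enormB_continuous x : continuous (fun y => enorm (y - x)).
Proof.
move=> y; apply: (@lipschitz_at_continuous y _ 1) => z; rewrite mul1r.
by apply: le_trans (normr_enormB_le _ _) _; rewrite opprB addrA subrK.
Qed.

Lemma dot_continuous x : continuous (dot x).
Proof.
move=> y; apply: (@lipschitz_at_continuous y (dot x) (enorm x)) => z.
by rewrite -dotBr normr_dot_le.
Qed.

End EuclideanTheory.

Section Diam.
Context {R : realType} {d : nat}.
Implicit Types (A : set 'rV[R]_d).

Lemma compact_enorm_bounded A : compact A ->
  exists2 r : R, 0 < r & forall x, A x -> enorm x <= r.
Proof.
move=> /compact_bounded[r [_ rA]].
have r0 : 0 < `|r| + 1 by rewrite ltr_wpDl.
exists (d%:R * (`|r| + 1) + 1); first by rewrite ltr_wpDl// mulr_ge0// ltW.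
move=> x Ax; apply: le_trans (enorm_le_sup_norm _) _.
have := rA (`|r| + 1); rewrite ltr_pwDr ?ler_norm// => /(_ isT x Ax) xr.
by apply: le_trans (ler_wpM2l _ xr) _; rewrite ?lerDl.
Qed.

Lemma enorm_le_diam A x y : compact A -> A x -> A y -> enorm (x - y) <= diam A.
Proof.
move=> /compact_enorm_bounded[r r0 rA] Ax Ay.
apply: ub_le_sup; last by exists x, y.
exists (r + r) => _ [u [v [Au Av ->]]].
by apply: le_trans (enormD _ _) _; rewrite enormN lerD ?rA.
Qed.

Lemma diam_ge0 A : compact A -> A !=set0 -> 0 <= diam A.
Proof.
by move=> cA [x Ax]; apply: le_trans (enorm_le_diam cA Ax Ax); exact: enorm_ge0.
Qed.

End Diam.

(** * Subgradients, second differences and the Legendre transform *)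

Definition subgradient {R : realType} {d : nat} (f : 'rV[R]_d -> R) (x p : 'rV[R]_d) :=
  forall z, f x + dot (z - x) p <= f z.

Definition second_diff {R : realType} {d : nat} (f : 'rV[R]_d -> R) (x v : 'rV[R]_d) : R :=
  f (x + v) + f (x - v) - 2 * f x.

(** By convexity, these bound the second differences in every direction. *)
Definition axis_diff {R : realType} {d : nat} (f : 'rV[R]_d -> R) (b : R) (x : 'rV[R]_d) : R :=
  \sum_(j < d) second_diff f x (b *: delta_mx 0 j).

Definition dotr {R : realType} {d : nat} (p x : 'rV[R]_d) : R := dot x p.

Lemma dotr_is_linear {R : realType} {d : nat} (p : 'rV[R]_d) : linear (dotr p : _ -> R^o).
Proof. by move=> a x y; rewrite /dotr dotDl dotZl. Qed.

HB.instance Definition _ {R : realType} {d : nat} (p : 'rV[R]_d) :=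
  GRing.isLinear.Build R 'rV[R]_d R^o *:%R (dotr p) (dotr_is_linear p).

Section ConvexFunctions.
Context {R : realType} {d : nat} (f : 'rV[R]_d -> R).
Implicit Types (x c p q u v y : 'rV[R]_d) (a b e t : R).
Hypothesis subf : forall x, exists p, subgradient f x p.

Lemma second_diff_ge0 x v : 0 <= second_diff f x v.
Proof.
have [p fp] := subf x; have := fp (x + v); have := fp (x - v).
rewrite addrAC subrr add0r (addrAC x v) subrr add0r dotNl /second_diff; lra.
Qed.

Lemma axis_diff_ge0 b x : 0 <= axis_diff f b x.
Proof. by apply: sumr_ge0 => j _; exact: second_diff_ge0. Qed.

Lemma subgradient_excess_ge0 x p v : subgradient f x p -> 0 <= f (x + v) - f x - dot v p.
Proof. by move=> /(_ (x + v)); rewrite addrAC subrr add0r; lra. Qed.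

Lemma subgradient_excess_le_second_diff x p v : subgradient f x p ->
  f (x + v) - f x - dot v p <= second_diff f x v.
Proof.
by move=> /(subgradient_excess_ge0 (- v)); rewrite dotNl /second_diff; lra.
Qed.

(** Convexity along a segment, read off from a subgradient at its intermediate
    point. *)
Lemma subgradient_excess_scale x p v t : 0 <= t <= 1 -> subgradient f x p ->
  f (x + t *: v) - f x - dot (t *: v) p <= t * (f (x + v) - f x - dot v p).
Proof.
move=> /andP[t0 t1] fp; have [q fq] := subf (x + t *: v).
have := fq x; have := fq (x + v).
rewrite opprD (addrACA x v) subrr add0r addrA subrr add0r dotBl dotNl !dotZl.
set A := f (x + _); set B := f (x + v); set C := f x; set D := dot v q.
move=> h1 h2.
have : 0 <= t * (B - (A + (D - t * D))) by rewrite mulr_ge0// subr_ge0.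
have : 0 <= (1 - t) * (C - (A - t * D)) by rewrite mulr_ge0// subr_ge0.
lra.
Qed.

(** A small vector is a convex combination of [0] and of vectors [b e_j] and
    [- b e_j], where the convex function is controlled by [axis_diff]. *)
Lemma subgradient_excess_le_axis_diff c p v b : 0 < b -> subgradient f c p ->
  \sum_i `|v 0 i| <= b -> f (c + v) - f c - dot v p <= axis_diff f b c.
Proof.
move=> b0 fp vb; have [q fq] := subf (c + v).
pose w j : 'rV[R]_d := (if 0 <= v 0 j then b else - b) *: delta_mx 0 j.
pose l j := `|v 0 j| / b.
have l0 j : 0 <= l j by rewrite divr_ge0 ?normr_ge0 ?ltW.
have lsum : \sum_j l j <= 1 by rewrite -mulr_suml ler_pdivrMr// mul1r.
have l1 j : l j <= 1.
  apply: le_trans lsum; rewrite (bigD1 j)//= lerDl.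
  by apply: sumr_ge0.
have lw : \sum_j l j *: w j = v.
  rewrite [RHS]row_sum_delta; apply: eq_bigr => j _; rewrite scalerA; congr (_ *: _).
  rewrite /l; case: ifP => vj; first by rewrite mulfVK ?gt_eqF// ger0_norm.
  by rewrite mulrN mulfVK ?gt_eqF// ltr0_norm ?opprK// ltNge vj.
have wle j : f (c + w j) - f c - dot (w j) p <= second_diff f c (b *: delta_mx 0 j).
  rewrite /w; case: ifP => _; first exact: subgradient_excess_le_second_diff.
  rewrite scaleNr; apply: le_trans (subgradient_excess_le_second_diff _ fp) _.
  by rewrite /second_diff opprK [f _ + _]addrC.
clearbody w l.
have step j : l j * (f (c + v) - f c) + l j * dot (w j) q - l j * dot v q
    - l j * dot (w j) p <= second_diff f c (b *: delta_mx 0 j).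
  apply: (@le_trans _ _ (l j * second_diff f c (b *: delta_mx 0 j))); last first.
    by rewrite ler_piMl ?second_diff_ge0.
  have := fq (c + w j); rewrite opprD (addrACA c) subrr add0r dotBl => h.
  rewrite -!mulrDr -!mulrBr ler_wpM2l//; apply: le_trans (wle j); lra.
have := @ler_sum _ _ (index_enum 'I_d) predT _ _ (fun j _ => step j).
rewrite -/(axis_diff f b c).
have dvE y : \sum_j l j * dot (w j) y = dot v y.
  by rewrite -[in RHS]lw dot_suml; apply: eq_bigr => j _; rewrite dotZl.
have -> : \sum_j (l j * (f (c + v) - f c) + l j * dot (w j) q - l j * dot v q
    - l j * dot (w j) p) = (\sum_j l j) * (f (c + v) - f c) + dot v q
    - (\sum_j l j) * dot v q - dot v p.
  by rewrite !big_split/= !sumrN -!mulr_suml !dvE.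
apply: le_trans; set L := \sum_j l j.
have := fq c; rewrite opprD addrA subrr add0r dotNl => h {step}.
have : 0 <= (1 - L) * (f c - (f (c + v) - dot v q)).
  by rewrite mulr_ge0// subr_ge0.
lra.
Qed.

(** Both [x + e *: u] and [x - e *: u] are so close to [c] that the axis differences
    at [c] bound the excess of [f] there over its tangent at [c]. *)
Lemma second_diff_le_axis_diff x c u e b : 0 <= e -> 0 < b -> enorm u <= 1 ->
  Num.sqrt d%:R * (enorm (x - c) + e) <= b ->
  second_diff f x (e *: u) <= 2 * axis_diff f b c.
Proof.
move=> e0 b0 u1 ebb; have [p fp] := subf c.
have key t : `|t| <= 1 ->
    f (x + t *: (e *: u)) - f c - dot (x - c + t *: (e *: u)) p <= axis_diff f b c.
  move=> t1; rewrite -{1}(subrKC c x) -[c + _ + _]addrA.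
  apply: subgradient_excess_le_axis_diff => //.
  apply: le_trans (sum_abs_le_enorm predT _) _; rewrite card_ord.
  apply: le_trans ebb; rewrite ler_wpM2l ?sqrtr_ge0//.
  apply: le_trans (enormD _ _) _; rewrite lerD2l !enormZ (ger0_norm e0).
  rewrite mulrA mulrAC ler_piMl// -[1]mul1r ler_pM ?normr_ge0 ?enorm_ge0//.
have := key 1; rewrite normr1 scale1r lexx => /(_ isT).
have := key (-1); rewrite normrN1 scaleN1r lexx => /(_ isT).
rewrite !dotDl !dotNl /second_diff.
have := subgradient_excess_ge0 (x - c) fp; rewrite subrKC dotDl dotNl; lra.
Qed.

(** Add the lower bounds for [f] given by [y] at [x + e *: u] and by [p] at
    [x - e *: u], where [u] is the direction of [y - p]. *)
Lemma dist_subgradient_le x p y e g S : 0 < e -> subgradient f x p ->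
  (forall z, f x + dot (z - x) y - g <= f z) ->
  (forall u, enorm u <= 1 -> second_diff f x (e *: u) <= S) ->
  e * enorm (y - p) <= g + S.
Proof.
move=> e0 fp fy uS.
have [yp0|yp0] := eqVneq (enorm (y - p)) 0.
  have := uS 0; rewrite enorm0 ler01 => /(_ isT).
  have := second_diff_ge0 x (e *: 0); have := fy x.
  by rewrite yp0 mulr0 subrr dot0l; lra.
have yp : 0 < enorm (y - p) by rewrite lt_def yp0 enorm_ge0.
pose u := (enorm (y - p))^-1 *: (y - p).
have u1 : enorm u = 1 by rewrite enormZ gtr0_norm ?invr_gt0// mulVf.
have uyp : dot u y - dot u p = enorm (y - p).
  by rewrite -dotBr dotZl -enorm_sqr expr2 mulKf.
clearbody u.
have := uS u; rewrite u1 lexx => /(_ isT).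
have := fp (x - e *: u); have := fy (x + e *: u).
rewrite [x + _ - x]addrAC [x - _ - x]addrAC subrr !add0r dotNl !dotZl /second_diff.
have : e * enorm (y - p) = e * dot u y - e * dot u p by rewrite -uyp mulrBr.
lra.
Qed.

(** The excess over a subgradient lies between zero and the second difference, so
    one scale [t] where second differences are at most [e * t] controls, by
    convexity, the excess at all smaller scales. *)
Lemma gradientE x p : subgradient f x p ->
  (forall e, 0 < e -> exists2 t, 0 < t &
     forall u, enorm u <= 1 -> second_diff f x (t *: u) <= e * t) ->
  gradient f x = p.
Proof.
move=> fp fx; suff dfp : 'd f x = dotr p :> ('rV[R]_d -> R).
  by apply/rowP => i; rewrite mxE dfp /dotr dot_delta.
apply: diff_unique.
  have dotrE : dotr p = dot p by apply/funext => y; rewrite /dotr dotC.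
  by move=> y; rewrite /= dotrE; exact: dot_continuous.
apply/eqaddoP => e e0.
have e'0 : 0 < e / (d%:R + 1) by rewrite divr_gt0// ltr_wpDl.
have [t t0 tP] := fx _ e'0.
apply/nbhs_ballP; exists (t / (d%:R + 1)) => /=.
  by rewrite divr_gt0// ltr_wpDl.
move=> h; rewrite -ball_normE/= sub0r normrN => ht.
have hd : enorm h <= (d%:R + 1) * `|h|.
  by apply: le_trans (enorm_le_sup_norm _) _; rewrite ler_wpM2r// lerDl.
have {ht}ht : enorm h <= t.
  apply: le_trans hd _; rewrite mulrC -ler_pdivlMr ?ltr_wpDl//; exact: ltW.
rewrite [X in `|X|](_ : _ = f (x + h) - f x - dot h p); last first.
  by rewrite !fctE /= /dotr [h + x]addrC opprD addrA.
rewrite ger0_norm; last exact: subgradient_excess_ge0.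
apply: (@le_trans _ _ (e / (d%:R + 1) * enorm h)); last first.
  rewrite -mulrA ler_wpM2l ?(ltW e0)// mulrC ler_pdivrMr ?ltr_wpDl//.
  by rewrite mulrC.
have [h0|hn0] := eqVneq (enorm h) 0.
  by rewrite h0 (enorm_eq0 h0) addr0 subrr dot0l subr0 mulr0.
have hp : 0 < enorm h by rewrite lt_def hn0 enorm_ge0.
pose u := (enorm h)^-1 *: h.
have hE : (enorm h / t) *: (t *: u) = h.
  by rewrite !scalerA divfK ?gt_eqF// mulfV ?scale1r.
have u1 : enorm u <= 1 by rewrite enormZ gtr0_norm ?invr_gt0// mulVf.
have ht1 : 0 <= enorm h / t <= 1.
  by rewrite divr_ge0 ?enorm_ge0 ?(ltW t0)//= ler_pdivrMr// mul1r.
have := subgradient_excess_scale (t *: u) ht1 fp; rewrite hE => /le_trans; apply.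
have -> : e / (d%:R + 1) * enorm h = enorm h / t * (e / (d%:R + 1) * t).
  by rewrite [RHS]mulrCA; congr (_ * _); rewrite divfK ?gt_eqF.
rewrite ler_wpM2l ?(andP ht1).1//.
apply: le_trans (subgradient_excess_le_second_diff _ fp) _; exact: tP.
Qed.

End ConvexFunctions.

Section Legendre.
Context {R : realType} {d : nat}.
Implicit Types (Y : set 'rV[R]_d) (psi : 'rV[R]_d -> R) (x y : 'rV[R]_d).

Lemma within_continuous_dotB Y psi x : C0 Y psi ->
  {within Y, continuous (fun y => dot x y - psi y)}.
Proof.
move=> cpsi y; apply: continuousB; last exact: cpsi.
by apply: continuous_subspaceT; exact: dot_continuous.
Qed.

Lemma legendre_attained Y psi x : compact Y -> Y !=set0 -> C0 Y psi ->
  exists2 y, Y y & legendre Y psi x = dot x y - psi y /\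
                   (forall z, Y z -> dot x z - psi z <= dot x y - psi y).
Proof.
move=> cY Y0 /(within_continuous_dotB (x := x)) /(compact_EVT_max Y0 cY)[y].
rewrite inE => Yy ymax0.
have ymax z : Y z -> dot x z - psi z <= dot x y - psi y.
  by move=> Yz; apply: ymax0; rewrite inE.
exists y => //; split => //; apply/eqP; rewrite eq_le; apply/andP; split.
  by apply: ge_sup => [|_ [z Yz <-]]; [by exists (dot x y - psi y), y|exact: ymax].
by apply: ub_le_sup; [exists (dot x y - psi y) => _ [z Yz <-]; exact: ymax|exists y].
Qed.

Lemma legendre_ge Y psi x y : compact Y -> C0 Y psi -> Y y ->
  dot x y - psi y <= legendre Y psi x.
Proof.
move=> cY cpsi Yy; have Y0 : Y !=set0 by exists y.
by have [z _ [-> /(_ y Yy)]] := legendre_attained x cY Y0 cpsi.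
Qed.

Lemma legendre_subgradient Y psi : compact Y -> Y !=set0 -> C0 Y psi ->
  forall x, exists2 p, Y p & subgradient (legendre Y psi) x p.
Proof.
move=> cY Y0 cpsi x; have [y Yy [xy _]] := legendre_attained x cY Y0 cpsi.
exists y => // z; apply: le_trans (legendre_ge z cY cpsi Yy).
by rewrite xy dotBl; lra.
Qed.

End Legendre.

(** * Second differences summed over a lattice *)

Section FiniteSums.

Lemma sum_shift_diff (V : zmodType) (u : nat -> V) (m n : nat) :
  \sum_(k < m) (u (k + n)%N - u k) = \sum_(i < n) (u (m + i)%N - u i).
Proof.
elim: m => [|m IH].
  by rewrite big_ord0 big1// => i _; rewrite add0n subrr.
rewrite big_ord_recr/= IH -[u m in LHS]/(u m).
have -> : u (m + n)%N - u m = \sum_(i < n) (u (m + i.+1)%N - u (m + i)%N).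
  by rewrite -(big_mkord predT (fun i => u (m + i.+1)%N - u (m + i)%N))
    (telescope_sumr (fun i => u (m + i)%N))// addn0.
rewrite -big_split/=; apply: eq_bigr => i _.
by rewrite addrC subrKA addnS addSn.
Qed.

Variables (I K : finType).
Implicit Types (z : {ffun I -> K}).

Definition upd z j k : {ffun I -> K} := [ffun i => if i == j then k else z i].

(** Each function is counted [#|K|] times, because exchanging [k] with the value
    at [j] is an involution on the pairs [(z, k)]. *)
Lemma sum_upd (V : nmodType) (j : I) (F : {ffun I -> K} -> V) :
  \sum_z \sum_k F (upd z j k) = (\sum_z F z) *+ #|K|.
Proof.
pose h (p : {ffun I -> K} * K) := (upd p.1 j p.2, p.1 j).
have hK : involutive h.
  move=> [z k]; rewrite /h/=; congr (_, _); last by rewrite ffunE eqxx.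
  by apply/ffunP => i; rewrite !ffunE; case: eqP => // ->.
rewrite pair_big/= (reindex_inj (inv_inj hK)).
rewrite (eq_bigr (fun p => F p.1)); last first.
  by move=> p _; rewrite -[upd _ _ _]/((h (h p)).1) hK.
rewrite -(pair_big predT predT (fun z _ => F z))/= -sumrMnl.
by apply: eq_bigr => z _; rewrite sumr_const.
Qed.

Lemma sum_prod_neq (R : comNzRingType) (j : I) (g : K -> R) :
  \sum_(z : {ffun I -> K}) \prod_(i | i != j) g (z i) = (\sum_k g k) ^+ #|I|.-1 *+ #|K|.
Proof.
transitivity (\prod_i \sum_k (if i == j then 1 else g k)).
  rewrite bigA_distr_bigA/=; apply: eq_bigr => z _.
  rewrite [RHS](bigD1 j)//= eqxx mul1r; apply: eq_bigr => i ij.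
  by rewrite (negPf ij).
rewrite (bigD1 j)//= eqxx sumr_const -mulr_natl; congr (_ * _).
rewrite (eq_bigr (fun=> \sum_k g k)); last by move=> i /negPf ->.
by rewrite prodr_const cardC1.
Qed.

End FiniteSums.

Section Lattice.
Context {R : realType}.

Definition centered {N : nat} (k : 'I_N.*2.+1) : R := k%:R - N%:R.

(** From [lam <= expR lam - 1], the geometric series of ratio [expR (- lam)] sums
    to at most [1 / lam]. *)
Lemma sum_exp_centered (N : nat) (lam : R) : 0 < lam ->
  \sum_(k < N.*2.+1) expR (- (lam * `|centered k|)) <= 1 + 2 / lam.
Proof.
move=> lam0; pose q := expR (- lam).
have q0 : 0 < q := expR_gt0 _.
have lq : lam * q <= 1 - q.
  have := expR_ge1Dx lam; rewrite -(ler_pM2l q0) -expRD addNr expR0; lra.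
pose s := \sum_(m < N) q ^+ m.+1.
have ls : lam * s <= 1 - q ^+ N.
  rewrite /s; elim: (N) => [|m IH]; first by rewrite big_ord0 mulr0 expr0 subrr.
  rewrite big_ord_recr/= mulrDr.
  have : 0 <= q ^+ m * (1 - q - lam * q) by rewrite mulr_ge0 ?subr_ge0// exprn_ge0// ltW.
  rewrite exprS; lra.
have s1 : s <= 1 / lam.
  rewrite ler_pdivlMr// mulrC; apply: le_trans ls _.
  by rewrite lerBlDr lerDl exprn_ge0// ltW.
suff -> : \sum_(k < N.*2.+1) expR (- (lam * `|centered k|)) = s + (1 + s) by lra.
have NN : N.*2.+1 = (N + N.+1)%N by rewrite addnS addnn.
rewrite /centered -(big_mkord predT (fun k => expR (- (lam * `|k%:R - N%:R|)))) NN.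
rewrite big_mkord big_split_ord/= big_ord_recl/=; congr (_ + (_ + _)).
- rewrite /s [RHS](reindex_inj rev_ord_inj)/=; apply: eq_bigr => k _.
  rewrite ltr0_norm ?subr_lt0 ?ltr_nat// opprB -natrB ?(ltnW (ltn_ord k))//.
  by rewrite -mulNr [_ * _%:R]mulrC expRM_natl subnSK.
- by rewrite addn0 subrr normr0 mulr0 oppr0 expR0.
- apply: eq_bigr => k _; rewrite natrD addrAC subrr add0r ger0_norm//.
  by rewrite /bump/= add1n -mulNr [_ * _%:R]mulrC expRM_natl.
Qed.

Context {d : nat} (f : 'rV[R]_d -> R) (Y : set 'rV[R]_d) (L : R).
Hypothesis subf : forall x, exists2 p, Y p & subgradient f x p.
Hypothesis diamY : forall p q, Y p -> Y q -> enorm (q - p) <= L.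

Let subf' x : exists p, subgradient f x p.
Proof. by have [p _ ?] := subf x; exists p. Qed.

(** Along a line, second differences telescope to a difference of slopes. *)
Lemma sum_second_diff_line (a : 'rV[R]_d) (j : 'I_d) (l : R) (m n : nat) : 0 <= l ->
  \sum_(k < m) second_diff f (a + (k%:R * l) *: delta_mx 0 j) ((n%:R * l) *: delta_mx 0 j)
  <= n%:R * (n%:R * l * L).
Proof.
move=> l0; set b := n%:R * l; have b0 : 0 <= b by rewrite mulr_ge0.
pose x (t : R) := a + (t * l) *: delta_mx 0 j : 'rV[R]_d.
have xD s t : x (s + t) = x s + (t * l) *: delta_mx 0 j.
  by rewrite /x mulrDl scalerDl addrA.
pose u (k : nat) := f (x k%:R) - f (x k%:R - b *: delta_mx 0 j).
rewrite (eq_bigr (fun k : 'I_m => u (k + n)%N - u k)); last first.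
  move=> k _; rewrite /u natrD xD -/b addrK /second_diff /x; lra.
rewrite sum_shift_diff mulr_natl -[n in leRHS]card_ord -sumr_const.
apply: ler_sum => i _; rewrite /u.
have [q Yq fq] := subf (x (m + i)%N%:R).
have [p Yp fp] := subf (x i%:R - b *: delta_mx 0 j).
have := fq (x (m + i)%N%:R - b *: delta_mx 0 j); have := fp (x i%:R).
rewrite subKr [_ - _ - _]addrAC subrr add0r dotNl !dotZl !dot_delta => h1 h2.
have : b * (q 0 j - p 0 j) <= b * L.
  rewrite ler_wpM2l//; apply: le_trans (diamY Yp Yq).
  by apply: le_trans (ler_norm _) _; have := coord_le_enorm (q - p) j; rewrite !mxE.
lra.
Qed.

Definition lattice_point {N : nat} (x0 : 'rV[R]_d) (l : R) (z : {ffun 'I_d -> 'I_N.*2.+1}) :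
  'rV[R]_d := x0 + l *: \row_i centered (z i).

Lemma lattice_point_upd (N : nat) x0 l (z : {ffun 'I_d -> 'I_N.*2.+1}) j k :
  lattice_point x0 l (upd z j k) =
  lattice_point x0 l (upd z j ord0) + (k%:R * l) *: delta_mx 0 j.
Proof.
rewrite /lattice_point -addrA mulrC -scalerA -scalerDr; congr (_ + _ *: _).
apply/rowP => i; rewrite !mxE !ffunE eqxx/=; case: eqVneq => _.
  by rewrite /centered mulr1 sub0r addrC.
by rewrite mulr0 addr0.
Qed.

(** Axis differences summed over the lattice points selected by [P]. For each
    axis the points are sorted into lines parallel to it. The lines meeting [P] are
    counted by an exponential moment: as the points of [P] have [l^1]-norm at most
    [T] off the axis, the indicator of [P] is at most [expR (lam * T)] times a
    product over the other coordinates, whose sum factorises. *)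
Lemma sum_axis_diff_lattice (N n : nat) x0 (l lam T : R)
    (P : pred {ffun 'I_d -> 'I_N.*2.+1}) : 0 <= l -> 0 < lam -> 0 <= L ->
  (forall z j, P z -> \sum_(i | i != j) `|centered (z i)| <= T) ->
  \sum_(z | P z) axis_diff f (n%:R * l) (lattice_point x0 l z) <=
  d%:R * (n%:R * (n%:R * l * L)) * expR (lam * T) * (1 + 2 / lam) ^+ d.-1.
Proof.
move=> l0 lam0 L0 PT; rewrite exchange_big/=.
set B := n%:R * (n%:R * l * L).
have B0 : 0 <= B by rewrite !mulr_ge0.
rewrite -mulrA -mulrA [leRHS]mulr_natl -[X in _ <= _ *+ X](card_ord d) -sumr_const.
apply: ler_sum => j _; pose g (k : 'I_N.*2.+1) := expR (- (lam * `|centered k|)).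
pose D (z : {ffun 'I_d -> 'I_N.*2.+1}) :=
  second_diff f (lattice_point x0 l z) ((n%:R * l) *: delta_mx 0 j).
have D0 z : 0 <= D z by exact: second_diff_ge0.
pose w (z : {ffun 'I_d -> 'I_N.*2.+1}) := \prod_(i | i != j) g (z i).
have w0 z : 0 <= w z by apply: prodr_ge0 => i _; exact: expR_ge0.
have wupd z k : w (upd z j k) = w z.
  by apply: eq_bigr => i /negPf ij; rewrite ffunE ij.
have wT z : P z -> 1 <= expR (lam * T) * w z.
  move=> /(PT z j) zT; rewrite /w -expR_sum -expRD -expR0 ler_expR.
  by rewrite sumrN -mulr_sumr subr_ge0 ler_pM2l.
(* The weight [w] does not see the coordinate [j], so it can be summed after the
   telescoping along [j]. *)
apply: (@le_trans _ _ (expR (lam * T) * \sum_z w z * D z)).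
  rewrite mulr_sumr big_mkcond; apply: ler_sum => z _; case: ifPn => [/wT h|_].
    by rewrite mulrA -/(D z); apply: ler_peMl.
  by rewrite !mulr_ge0 ?expR_ge0.
rewrite [leRHS]mulrCA ler_wpM2l ?expR_ge0//.
have K0 : 0 < (N.*2.+1)%:R :> R by [].
rewrite -(ler_pM2l K0) [leLHS]mulr_natl [leRHS]mulr_natl -[X in _ *+ X <= _]card_ord -(sum_upd j).
under eq_bigr => z _.
  under eq_bigr => k _ do rewrite wupd /D lattice_point_upd.
  rewrite -mulr_sumr; over.
apply: (@le_trans _ _ (\sum_z w z * B)).
  by apply: ler_sum => z _; rewrite ler_wpM2l// sum_second_diff_line.
rewrite -mulr_suml sum_prod_neq !card_ord mulrC mulrnAr lerMn2r/= ler_wpM2l//.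
have S0 : 0 <= \sum_k g k by apply: sumr_ge0 => k _; exact: expR_ge0.
have S1 : \sum_k g k <= 1 + 2 / lam by exact: sum_exp_centered.
by rewrite lerXn2r ?nnegrE //; exact: (le_trans S0 S1).
Qed.

End Lattice.

(** * Volumes of Euclidean balls *)

(** The integral of a nonnegative function is a supremum over the simple functions
    below it, so it is monotone on functions that need not be measurable. *)
Lemma ge0_le_integral_nomeas d (T : measurableType d) (R : realType)
    (mu : {measure set T -> \bar R}) (D : set T) (f g : T -> \bar R) :
  (forall x, D x -> 0 <= f x)%E -> (forall x, D x -> f x <= g x)%E ->
  (\int[mu]_(x in D) f x <= \int[mu]_(x in D) g x)%E.
Proof.
move=> f0 fg; rewrite !(integral_mkcond D).
rewrite !ge0_integralTE => [||x]; last 2 first.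
- by apply: erestrict_ge0 => x Dx; exact: le_trans (f0 x Dx) (fg x Dx).
- exact: erestrict_ge0.
apply: le_ereal_sup => _ [h hf <-]; exists h => // x.
by apply: le_trans (hf x) _; exact: lee_restrict.
Qed.

Section BallVolume.
Context {R : realType}.
Notation leb := (@lebesgue_measure R).

(** Rescaled by [1 / c], the image of the Lebesgue measure under division by [c]
    has the right value on intervals, hence is the Lebesgue measure. *)
Lemma ge0_integral_lebesgue_scale (c : R) (h : R -> \bar R) : 0 < c ->
  measurable_fun [set: R] h -> (forall t, 0 <= h t)%E ->
  (\int[leb]_t h (t / c)%R = c%:E * \int[leb]_t h t)%E.
Proof.
move=> c0 mh h0.
pose phi (t : measurableTypeR R) : measurableTypeR R := t / c.
have mphi : measurable_fun setT phi by exact: measurable_funM.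
have -> : (\int[leb]_t h (t / c)%R = \int[pushforward leb phi]_t h t)%E.
  by rewrite ge0_integral_pushforward.
rewrite -(ge0_integral_mscale leb measurableT (NngNum (ltW c0)))//.
apply: eq_measure_integral => A mA _.
pose ic := NngNum (ltW (divr_gt0 (@ltr01 R) c0)).
have cic : (c%:E * (1 / c)%:E = 1)%E by rewrite -EFinM mulrC divfK ?gt_eqF.
pose nu : {measure set (measurableTypeR R) -> \bar R} := mscale ic (pushforward leb phi).
suff E : leb A = nu mphi A.
  transitivity (c%:E * leb A)%E; last by [].
  rewrite E; transitivity (c%:E * ((1 / c)%:E * leb (phi @^-1` A)))%E; last by [].
  by rewrite muleA cic mul1e.
apply: (@lebesgue_measure_unique R (nu mphi)) => // _ [[a b]] _ <-.
transitivity ((1 / c)%:E * leb (phi @^-1` `]a, b]))%E; last by [].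
have -> : phi @^-1` `]a, b] = `](a * c), (b * c)]%classic.
  apply/seteqP; split => t /=; rewrite !in_itv/= /phi.
    by rewrite ltr_pdivlMr// ler_pdivrMr.
  by rewrite ltr_pdivlMr// ler_pdivrMr.
rewrite !lebesgue_measure_itv/= !lte_fin ltr_pM2r//; case: ifPn => _; last by rewrite mule0.
by rewrite -!EFinB -EFinM; congr (_%:E); field; rewrite gt_eqF.
Qed.

(** Volume of the [k]-ball of squared radius [s], relative to that of the unit
    ball. *)
Definition ball_profile (k : nat) (s : R) : R := if 0 < s then Num.sqrt s ^+ k else 0.

Lemma ball_profile_ge0 k s : 0 <= ball_profile k s.
Proof. by rewrite /ball_profile; case: ifP => // _; rewrite exprn_ge0. Qed.

Lemma measurable_ball_profile k (f : R -> R) : measurable_fun setT f ->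
  measurable_fun setT (fun t => ball_profile k (f t)).
Proof.
move=> mf; apply: measurable_fun_ifT; first exact: measurable_fun_ltr.
  apply: measurable_funX; apply: measurableT_comp => //.
  by apply: continuous_measurable_fun; exact: sqrt_continuous.
exact: measurable_cst.
Qed.

Definition slice_integral (k : nat) : \bar R := (\int[leb]_t (ball_profile k (1 - t ^+ 2))%:E)%E.

Let measurable_slice k (s : R) :
  measurable_fun [set: R] (fun t : R => (ball_profile k (s - t ^+ 2))%:E).
Proof.
apply/measurable_EFinP; apply: measurable_ball_profile.
by apply: measurable_funB => //; exact: measurable_funX.
Qed.

Lemma slice_integral_le k : (slice_integral k <= 2%:E)%E.
Proof.
apply: (@le_trans _ _ (\int[leb]_t (\1_(`[(-1)%R, 1]%classic : set R) t)%:E)%E).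
  apply: ge0_le_integral_nomeas => t _; rewrite lee_fin ?ball_profile_ge0//.
  rewrite /ball_profile indicE; case: ifP => [t1|_]; last by case: (_ \in _).
  have t21 : t ^+ 2 < 1 by lra.
  have : `|t| <= 1 by rewrite -(@ler_pXn2r _ 2) ?nnegrE// real_normK ?num_real// expr1n ltW.
  rewrite ler_norml => t11; rewrite mem_set ?mulr1n /= ?in_itv//=.
  by rewrite exprn_ile1 ?sqrtr_ge0// -[leRHS]sqrtr1 ler_sqrt// gerBl sqr_ge0.
rewrite integral_indic//= setIT lebesgue_measure_itv/= lte_fin.
by rewrite gtrN ?ltr01// -EFinB lee_fin opprK.
Qed.

Lemma one_minus_le_expr (x : R) n : 0 <= x <= 1 -> 1 - n%:R * (1 - x) <= x ^+ n.
Proof.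
move=> /andP[x0 x1]; elim: n => [|n IH]; first by rewrite mul0r subr0.
rewrite exprS -natr1; have : 0 <= x * (x ^+ n - (1 - n%:R * (1 - x))).
  by rewrite mulr_ge0// subr_ge0.
have : 0 <= n%:R * (1 - x) ^+ 2 by rewrite mulr_ge0// sqr_ge0.
lra.
Qed.

(** Between the heights [- a] and [a], with [a ^+ 2 = 1 / (2 (k + 1))], Bernoulli's
    inequality gives every slice at least half the volume of the central one. *)
Lemma slice_integral_ge k : ((Num.sqrt (2 * k.+1%:R))^-1%:E <= slice_integral k)%E.
Proof.
set a : R := (Num.sqrt (2 * k.+1%:R))^-1.
have a0 : 0 < a by rewrite invr_gt0 sqrtr_gt0 mulr_gt0.
have a2 : a ^+ 2 = (2 * k.+1%:R)^-1 by rewrite exprVn sqr_sqrtr// mulr_ge0.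
have ka2 : k%:R * a ^+ 2 <= 1 / 2.
  by rewrite a2 ler_pdivrMr ?mulr_gt0// mulrA mulfVK// mul1r ler_nat.
have a21 : a ^+ 2 < 1.
  rewrite a2 invf_lt1 ?mulr_gt0//; have : 1 <= k.+1%:R :> R by rewrite ler1n.
  lra.
apply: (@le_trans _ _ (\int[leb]_t ((1 / 2) * \1_(`[- a, a]%classic : set R) t)%:E)%E).
  under eq_integral do rewrite EFinM.
  rewrite ge0_integralZl//=; last by apply/measurable_EFinP.
  rewrite integral_indic//= setIT lebesgue_measure_itv/= lte_fin gtrN//.
  by rewrite -EFinB -EFinM lee_fin; lra.
apply: ge0_le_integral_nomeas => t _; first by rewrite lee_fin mulr_ge0.
- rewrite lee_fin indicE mem_setE in_itv/=.
  case: andP => [[at1 at2]|_]; last by rewrite mulr0 ball_profile_ge0.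
  have t2 : t ^+ 2 <= a ^+ 2 by rewrite -real_normK ?num_real// lerXn2r ?nnegrE ?(ltW a0)// ler_norml at1.
  have u0 : 0 < 1 - t ^+ 2 by lra.
  have u1 : 1 - t ^+ 2 <= 1 by rewrite gerBl sqr_ge0.
  rewrite /ball_profile u0 mulr1.
  apply: (@le_trans _ _ ((1 - t ^+ 2) ^+ k)).
    apply: le_trans (one_minus_le_expr k _); last by rewrite (ltW u0).
    have -> : 1 - (1 - t ^+ 2) = t ^+ 2 by lra.
    have : k%:R * t ^+ 2 <= k%:R * a ^+ 2 by rewrite ler_wpM2l.
    lra.
  rewrite lerXn2r ?nnegrE ?sqrtr_ge0 ?(ltW u0)//.
  rewrite -[leLHS]sqr_sqrtr ?(ltW u0)// expr2 ler_piMl ?sqrtr_ge0//.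
  by rewrite -[leRHS]sqrtr1 ler_sqrt.
Qed.

(** Balls are indexed by the square of the radius, so that their slices are of the
    same form, and empty when the index is not positive. *)
Definition sqball (k : nat) (s : R) : set 'rV[R]_k := [set x | dot x x < s].
Arguments sqball : clear implicits.

Lemma dot_row_mx k t (x : 'rV[R]_k) :
  dot (row_mx t%:M x : 'rV[R]_(1 + k)) (row_mx t%:M x) = t ^+ 2 + dot x x.
Proof.
rewrite /dot big_split_ord/= big_ord1 row_mxEl !mxE eqxx mulr1n -expr2; congr (_ + _).
by apply: eq_bigr => i _; rewrite row_mxEr.
Qed.

(** Slicing at height [t] replaces [s] by [s - t ^+ 2]; the substitution of
    [Num.sqrt s * t] for [t] then takes the radius out of the integral. *)
Lemma volume_sqballS k c : 0 <= c ->
  (forall s, volume (sqball k s) = (c * ball_profile k s)%:E) ->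
  forall s, volume (sqball k.+1 s) =
    (c * fine (slice_integral k) * ball_profile k.+1 s)%:E.
Proof.
move=> c0 Vk s /=.
have slice t : [set x : 'rV[R]_k | sqball k.+1 s (row_mx t%:M x : 'rV[R]_(1 + k))] = sqball k (s - t ^+ 2).
  by apply/seteqP; split => x; rewrite /sqball/= (dot_row_mx t x) ltrBrDl.
under eq_integral do rewrite slice Vk EFinM.
rewrite ge0_integralZl//=; last 2 first.
  exact: measurable_slice.
  by move=> t _; rewrite lee_fin ball_profile_ge0.
rewrite EFinM EFinM -muleA; congr (_ * _)%E.
have Wfin : slice_integral k \is a fin_num.
  by rewrite ge0_fin_numE ?(le_lt_trans (slice_integral_le k)) ?ltry// integral_ge0// => t _; rewrite lee_fin ball_profile_ge0.
rewrite fineK// [in RHS]/ball_profile; case: ifPn => [s0|sn0]; last first.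
  rewrite mule0 integral0_eq// => t _; rewrite /ball_profile ifN//.
  rewrite -leNgt subr_le0; apply: le_trans (sqr_ge0 t); by rewrite leNgt.
have r0 : 0 < Num.sqrt s by rewrite sqrtr_gt0.
have scale t : (ball_profile k (s - t ^+ 2))%:E =
    ((Num.sqrt s ^+ k)%:E * (ball_profile k (1 - (t / Num.sqrt s) ^+ 2))%:E)%E.
  rewrite -EFinM; congr (_%:E).
  have -> : s - t ^+ 2 = s * (1 - (t / Num.sqrt s) ^+ 2).
    by rewrite expr_div_n sqr_sqrtr ?(ltW s0)// mulrBr mulr1 mulrC divfK ?gt_eqF.
  rewrite /ball_profile pmulr_rgt0//; case: ifPn => _; last by rewrite mulr0.
  by rewrite sqrtrM ?(ltW s0)// exprMn.
under eq_integral do rewrite scale.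
rewrite ge0_integralZl//=; last 2 first.
- apply/measurable_EFinP; apply: measurable_ball_profile.
  by apply: measurable_funB => //; apply: measurable_funX; apply: measurable_funM.
- by move=> t _; rewrite lee_fin ball_profile_ge0.
rewrite (ge0_integral_lebesgue_scale (h := fun t => (ball_profile k (1 - t ^+ 2))%:E))//.
- by rewrite muleA -EFinM -exprSr muleC.
- by move=> t; rewrite lee_fin ball_profile_ge0.
Qed.

Lemma eball0E k : eball (0 : 'rV[R]_k) 1 = sqball k 1.
Proof.
apply/seteqP; split => x; rewrite /eball /sqball/= subr0.
  by rewrite -enorm_sqr => x1; rewrite exprn_ilt1 ?enorm_ge0.
by rewrite /enorm -[in X in _ -> X]sqrtr1 ltr_sqrt.
Qed.

Lemma volume_sqball k :
  0 < unit_ball_volume R k /\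
  forall s, volume (sqball k s) = (unit_ball_volume R k * ball_profile k s)%:E.
Proof.
suff [c c0 Vc] : exists2 c, 0 < c &
    forall s, volume (sqball k s) = (c * ball_profile k s)%:E.
  have -> : unit_ball_volume R k = c.
    by rewrite /unit_ball_volume eball0E Vc/= /ball_profile ltr01 sqrtr1 expr1n mulr1.
  by [].
elim: k => [|k [c c0 Vc]].
  exists 1 => // s; rewrite /= /ball_profile expr0 mul1r indicE; congr (_%:E).
  have dot00 : dot (0 : 'rV[R]_0) 0 = 0 by rewrite /dot big_ord0.
  case: ifPn => s0; first by rewrite mem_set// /sqball/= dot00.
  by rewrite memNset// /sqball/= dot00; exact/negP.
exists (c * fine (slice_integral k)); last exact: volume_sqballS (ltW c0) Vc.
rewrite mulr_gt0// fine_gt0//.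
rewrite (le_lt_trans (slice_integral_le k)) ?ltry// andbT.
by apply: lt_le_trans (slice_integral_ge k); rewrite lte_fin invr_gt0 sqrtr_gt0.
Qed.

Lemma unit_ball_volume_ratio k :
  (Num.sqrt (2 * k.+1%:R))^-1 <= unit_ball_volume R k.+1 / unit_ball_volume R k.
Proof.
have [c0 Vk] := volume_sqball k.
have -> : unit_ball_volume R k.+1 = unit_ball_volume R k * fine (slice_integral k).
  rewrite {1}/unit_ball_volume eball0E (volume_sqballS (ltW c0) Vk) /ball_profile ltr01.
  by rewrite sqrtr1 expr1n mulr1.
rewrite mulrAC mulfV ?gt_eqF// mul1r -lee_fin fineK ?slice_integral_ge//.
rewrite ge0_fin_numE ?(le_lt_trans (slice_integral_le k)) ?ltry//.
by apply: le_trans (slice_integral_ge k); rewrite lee_fin invr_ge0 sqrtr_ge0.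
Qed.

(** Bernoulli's inequality for [(6 / 5) ^+ d.-1] makes the explicit constant of
    the covering estimate smaller than [c_const]. *)
Lemma covering_const_le d : (0 < d)%N ->
  16 / Num.sqrt 3 * d%:R ^+ 2 * Num.sqrt d%:R * 5 ^+ d.-1 <= c_const R d.
Proof.
case: d => // k _ /=; rewrite /c_const.
pose r : R := unit_ball_volume R k.+1 / unit_ball_volume R k.
have r0 : (Num.sqrt (2 * k.+1%:R))^-1 <= r := unit_ball_volume_ratio k.
pose n : R := k.+1%:R; rewrite -!/n; have n0 : 0 < n by rewrite ltr0n.
have -> : 4 / 3 * (6 ^+ k.+1 * n ^+ 2 * (n + 1) * unit_ball_volume R k.+1 /
  unit_ball_volume R k.+1.-1) = 8 * (6 ^+ k * n ^+ 2 * (n + 1)) * r.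
  by rewrite /r exprS /=; field; rewrite gt_eqF// (volume_sqball k).1.
clearbody r.
have sn : Num.sqrt n ^+ 2 = n by rewrite sqr_sqrtr// ltW.
have sn0 : 0 < Num.sqrt n by rewrite sqrtr_gt0.
have s2 : Num.sqrt 2 ^+ 2 = 2 :> R by rewrite sqr_sqrtr.
have s20 : 0 < Num.sqrt 2 :> R by rewrite sqrtr_gt0.
have s3 : Num.sqrt 3 ^+ 2 = 3 :> R by rewrite sqr_sqrtr.
have s30 : 0 < Num.sqrt 3 :> R by rewrite sqrtr_gt0.
have bernoulli : (1 + n / 5 - 1 / 5) * 5 ^+ k <= 6 ^+ k.
  rewrite /n; elim: k {r r0 n n0 sn sn0} => [|k IH]; first by rewrite !expr0 mulr1; lra.
  rewrite !exprS -[k.+2%:R]natr1.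
  have : 0 <= 5 ^+ k * (k.+1%:R - 1) :> R.
    by rewrite mulr_ge0 ?exprn_ge0// subr_ge0 ler1n.
  lra.
(* As [sqrt (2 / 3) <= 5 / 6], this follows from [(n - 5 / 3) ^+ 2 >= 0]. *)
have quad : 2 * (Num.sqrt 2 / Num.sqrt 3) * n <= (n + 1) * (1 + n / 5 - 1 / 5).
  have q0 : 0 < Num.sqrt 2 / Num.sqrt 3 :> R by rewrite divr_gt0.
  have q1 : (Num.sqrt 2 / Num.sqrt 3) ^+ 2 <= (5 / 6) ^+ 2 :> R.
    by rewrite expr_div_n s2 s3; lra.
  have q2 : Num.sqrt 2 / Num.sqrt 3 <= 5 / 6 :> R by rewrite -(@ler_pXn2r _ 2) ?nnegrE ?(ltW q0).
  have : 0 <= (5 / 6 - Num.sqrt 2 / Num.sqrt 3) * n by rewrite mulr_ge0 ?subr_ge0 ?(ltW n0).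
  have := sqr_ge0 (n - 5 / 3); lra.
have key : 2 * (Num.sqrt 2 / Num.sqrt 3) * n * 5 ^+ k <= (n + 1) * 6 ^+ k.
  apply: (@le_trans _ _ ((n + 1) * (1 + n / 5 - 1 / 5) * 5 ^+ k)).
    by rewrite ler_wpM2r ?exprn_ge0.
  by rewrite -mulrA ler_wpM2l// addr_ge0// ltW.
apply: (@le_trans _ _ (8 * (6 ^+ k * n ^+ 2 * (n + 1)) / Num.sqrt (2 * n))); last first.
  by rewrite ler_wpM2l// !mulr_ge0// ?exprn_ge0 ?addr_ge0 ?(ltW n0).
rewrite sqrtrM//.
have -> : 8 * (6 ^+ k * n ^+ 2 * (n + 1)) / (Num.sqrt 2 * Num.sqrt n) =
  8 / (Num.sqrt 2 * Num.sqrt n) * n ^+ 2 * ((n + 1) * 6 ^+ k).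
  by field; rewrite !gt_eqF.
have -> : 16 / Num.sqrt 3 * n ^+ 2 * Num.sqrt n * 5 ^+ k =
  8 / (Num.sqrt 2 * Num.sqrt n) * n ^+ 2 *
  (2 * (Num.sqrt 2 / Num.sqrt 3) * Num.sqrt n ^+ 2 * 5 ^+ k).
  by field; rewrite !gt_eqF.
by rewrite sn ler_wpM2l// mulr_ge0 ?sqr_ge0// divr_ge0// mulr_ge0// ltW.
Qed.

End BallVolume.

(** * A covering bound for second differences *)

Section Borel.
Context {R : realType} {d : nat}.
Implicit Types (A : set 'rV[R]_d) (f : 'rV[R]_d -> R) (x : 'rV[R]_d) (r : R).

Lemma open_measurable_borelRV A : open A -> measurable (A : set (borelRV R d)).
Proof. exact: sub_sigma_algebra. Qed.

Lemma closed_measurable_borelRV A : closed A -> measurable (A : set (borelRV R d)).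
Proof.
move=> cA; rewrite -[A]setCK; apply: measurableC.
by apply: open_measurable_borelRV; exact: closed_openC.
Qed.

Lemma compact_measurable_borelRV A : compact A -> measurable (A : set (borelRV R d)).
Proof.
move=> cA; apply: closed_measurable_borelRV; apply: compact_closed cA.
exact: norm_hausdorff.
Qed.

Lemma within_continuous_measurable_borelRV A f : closed A -> {within A, continuous f} ->
  measurable_fun (A : set (borelRV R d)) (f : borelRV R d -> R).
Proof.
move=> cA /continuousP cf; apply: (measurability _ (RGenOpens.measurableE R)).
move=> _ [_ [a [b ->] <-]].
have /open_subspaceP[V oV VA] : open (from_subspace A f @^-1` `]a, b[%classic).
  exact/cf/interval_open.
rewrite setIC -VA; apply: measurableI; first exact: open_measurable_borelRV.
exact: closed_measurable_borelRV.
Qed.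

Lemma continuous_measurable_borelRV f : continuous f ->
  measurable_fun [set: borelRV R d] (f : borelRV R d -> R).
Proof.
move=> cf; apply: within_continuous_measurable_borelRV; first exact: closedT.
exact: continuous_subspaceT.
Qed.

Lemma measurable_eball x r : measurable (eball x r : set (borelRV R d)).
Proof.
apply: open_measurable_borelRV.
rewrite (_ : eball x r = (fun y => enorm (y - x)) @^-1` [set t | t < r])//.
by apply: open_comp; [move=> y _; exact: enormB_continuous|exact: open_lt].
Qed.

Lemma measurable_coord i :
  measurable_fun [set: borelRV R d] (fun x : borelRV R d => (x : 'rV[R]_d) 0 i).
Proof.
by apply: continuous_measurable_borelRV => x; exact: coord_continuous.
Qed.

Definition cball (x : 'rV[R]_d) (r : R) : set 'rV[R]_d := [set y | enorm (y - x) <= r].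

Lemma measurable_cball x r : measurable (cball x r : set (borelRV R d)).
Proof.
apply: closed_measurable_borelRV.
rewrite (_ : cball x r = (fun y => enorm (y - x)) @^-1` [set t | t <= r])//.
apply: closed_comp; last exact: closed_le.
by move=> y _; exact: enormB_continuous.
Qed.

End Borel.

(** By continuity of the power at [r]; a growth condition on open balls thus passes
    to closed ones. *)
Lemma le_powR_limit (R : realType) (M p r v : R) : 0 < M -> 0 < p -> 0 < r ->
  (forall s, r < s -> v <= M * s `^ p) -> v <= M * r `^ p.
Proof.
move=> M0 p0 r0 vs; rewrite leNgt; apply/negP => vr.
pose w := (v + M * r `^ p) / 2.
have w1 : M * r `^ p < w by rewrite /w; lra.
have w2 : w < v by rewrite /w; lra.
have rp : r `^ p < w / M by rewrite ltr_pdivlMr// mulrC.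
have wM0 : 0 < w / M by apply: le_lt_trans rp; exact: powR_ge0.
have : r < (w / M) `^ p^-1.
  have -> : r = (r `^ p) `^ p^-1 by rewrite -powRrM mulfV ?gt_eqF// powRr1// ltW.
  by rewrite gt0_ltr_powR ?invr_gt0// nnegrE ?powR_ge0// ltW.
move=> /vs; rewrite -powRrM mulVf ?gt_eqF// powRr1 ?(ltW wM0)//.
by rewrite mulrCA divff ?gt_eqF// mulr1 => /le_lt_trans /(_ w2); rewrite ltxx.
Qed.

Section Covering.
Context {R : realType} {d : nat} (rho : probability (borelRV R d) R).
Variables (M theta D L eta : R) (X Y : set 'rV[R]_d) (f : 'rV[R]_d -> R) (x0 : 'rV[R]_d).
Hypotheses (d0 : (0 < d)%N) (M0 : 0 < M) (theta0 : 0 < theta) (L0 : 0 <= L).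
Hypotheses (eta0 : 0 < eta) (etaD : eta <= D).
Hypothesis growth : forall (x : 'rV[R]_d) (r : R), 0 < r ->
  (rho (eball x r) <= (M * r `^ (d%:R - 1 + theta))%:E)%E.
Hypothesis Xx0 : X x0.
Hypothesis diamX : forall x y, X x -> X y -> enorm (x - y) <= D.
Hypothesis subf : forall x, exists2 p, Y p & subgradient f x p.
Hypothesis diamY : forall p q, Y p -> Y q -> enorm (q - p) <= L.

Lemma cball_growth x r : 0 < r -> (rho (cball x r) <= (M * r `^ (d%:R - 1 + theta))%:E)%E.
Proof.
move=> r0.
have mb : measurable (cball x r : set (borelRV R d)) := measurable_cball x r.
have me s : measurable (eball x s : set (borelRV R d)) := measurable_eball x s.
have fin : rho (cball x r) \is a fin_num by exact: fin_num_measure.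
rewrite -(fineK fin) lee_fin; apply: le_powR_limit => //.
  by rewrite ltr_wpDl// subr_ge0 ler1n.
move=> s rs; rewrite -lee_fin fineK//; apply: le_trans (growth x (lt_trans r0 rs)).
by apply: le_measure; rewrite ?inE// => y /le_lt_trans; apply.
Qed.

(* A lattice cell of side [l] has half-diagonal [eta / 3]. *)
Let l : R := 2 * eta / (3 * Num.sqrt d%:R).
Let A := D / eta.

Let sd0 : 0 < Num.sqrt d%:R :> R. Proof. by rewrite sqrtr_gt0 ltr0n. Qed.
Let sd2 : Num.sqrt d%:R ^+ 2 = d%:R :> R. Proof. by rewrite sqr_sqrtr. Qed.
Let l0 : 0 < l. Proof. by rewrite divr_gt0 ?mulr_gt0. Qed.
Let d1 : d.-1%:R = d%:R - 1 :> R. Proof. by rewrite -[in RHS](prednK d0) -natr1 addrK. Qed.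
Let A1 : 1 <= A. Proof. by rewrite ler_pdivlMr// mul1r. Qed.

(* The step of the axis differences is a multiple of [l], so that they telescope,
   and is the least length allowed by [second_diff_le_axis_diff] at distance
   [eta / 3] from the lattice point. *)
Let b : R := d.*2%:R * l.
Let bE : b = Num.sqrt d%:R * (eta / 3 + eta).
Proof.
rewrite /b /l -muln2 natrM; set s := Num.sqrt d%:R.
by rewrite -sd2 -/s; field; rewrite gt_eqF.
Qed.
Let b0 : 0 < b. Proof. by rewrite bE mulr_gt0// addr_gt0 ?divr_gt0. Qed.

Lemma centered_nearest (N : nat) (t : R) : `|t| <= N%:R ->
  exists k : 'I_N.*2.+1, `|t - centered k| <= 1 / 2.
Proof.
rewrite ler_norml => /andP[tN1 tN2].
have t0 : 0 <= t + N%:R + 1 / 2 by lra.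
have /andP[m1 m2] := Num.Theory.truncn_itv t0.
set m := Num.truncn _ in m1 m2.
have mN : (m < N.*2.+1)%N.
  rewrite ltnS -(ltnS m) -(ltr_nat R) -addnn -natr1 natrD.
  lra.
have {}m2 : t + N%:R + 1 / 2 < m%:R + 1 by rewrite natr1.
exists (Ordinal mN); rewrite /centered/= ler_norml; clearbody m.
by apply/andP; split; lra.
Qed.

Let N : nat := Num.bound (D / l).

Let c (z : {ffun 'I_d -> 'I_N.*2.+1}) := lattice_point x0 l z.

Let near_X : pred {ffun 'I_d -> 'I_N.*2.+1} :=
  fun z => `[< exists2 x, X x & enorm (x - c z) <= eta / 3 >].

Lemma lattice_cover x : X x -> exists z, enorm (x - c z) <= eta / 3.
Proof.
move=> Xx.
have tN i : `|(x - x0) 0 i / l| <= N%:R.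
  rewrite normrM normfV (gtr0_norm l0) ler_pdivrMr//.
  apply: le_trans (coord_le_enorm _ _) _; apply: le_trans (diamX Xx Xx0) _.
  rewrite -ler_pdivrMr//; apply/ltW/(archi_boundP _).
  by rewrite divr_ge0 ?(ltW l0)// (le_trans (ltW eta0)).
pose k i := projT1 (cid (centered_nearest (tN i))).
have kP i : `|(x - x0) 0 i / l - centered (k i)| <= 1 / 2 := projT2 (cid (centered_nearest (tN i))).
exists [ffun i => k i].
have -> : eta / 3 = Num.sqrt d%:R * (l / 2) by rewrite /l; field; rewrite gt_eqF.
have l20 : 0 <= l / 2 by rewrite divr_ge0// ltW.
have sl0 : 0 <= Num.sqrt d%:R * (l / 2) by rewrite mulr_ge0 ?sqrtr_ge0.
rewrite -(@ler_pXn2r _ 2) ?nnegrE ?enorm_ge0// enorm_sqr exprMn sd2.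
rewrite mulr_natl -[X in _ <= _ *+ X](card_ord d) -sumr_const; apply: ler_sum => i _.
rewrite -expr2 -real_normK ?num_real// lerXn2r ?nnegrE ?normr_ge0//.
rewrite /c /lattice_point opprD addrA !mxE !ffunE.
have -> : x 0 i - x0 0 i - l * centered (k i) = l * ((x - x0) 0 i / l - centered (k i)).
  by rewrite !mxE; field; rewrite gt_eqF.
by rewrite normrM (gtr0_norm l0) ler_wpM2l ?(ltW l0)// (le_trans (kP i))// mul1r.
Qed.

(** A lattice point near [X] is at Euclidean distance at most [D + eta / 3] from
    [x0]; dropping one coordinate, Cauchy-Schwarz contributes [Num.sqrt d.-1%:R]. *)
Lemma near_X_l1 z j : near_X z -> \sum_(i | i != j) `|centered (z i) : R| <= (d%:R - 1 / 2) * (2 * A).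
Proof.
move=> /asboolP[x Xx xz].
have -> : \sum_(i | i != j) `|centered (z i) : R| =
    (\sum_(i | i != j) `|(c z - x0) 0 i|) / l.
  rewrite mulr_suml; apply: eq_bigr => i _.
  rewrite /c /lattice_point addrAC subrr add0r !mxE normrM (gtr0_norm l0).
  by rewrite mulrAC divff ?gt_eqF// mul1r.
rewrite ler_pdivrMr//; apply: le_trans (sum_abs_le_enorm _ _) _.
have -> : #|(fun i : 'I_d => i != j)| = d.-1 by rewrite cardC1 card_ord.
have cz : enorm (c z - x0) <= D + eta / 3.
  by apply: le_trans (enorm_triangle x _ _) _; rewrite addrC lerD ?diamX// enormB.
(* The geometric mean of [d - 1] and [d] is at most their arithmetic mean. *)
have sdd : Num.sqrt d.-1%:R * Num.sqrt d%:R <= d%:R - 1 / 2 :> R.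
  rewrite -sqrtrM//.
  have h : 0 <= d%:R - 1 / 2 :> R.
    by have : 1 <= d%:R :> R; [rewrite ler1n|lra].
  rewrite -[leRHS](ger0_norm h) -[leRHS]sqrtr_sqr.
  by rewrite ler_sqrt ?sqr_ge0// d1; lra.
apply: (@le_trans _ _ (Num.sqrt d.-1%:R * (D + eta / 3))).
  by rewrite ler_wpM2l ?sqrtr_ge0.
have -> : Num.sqrt d.-1%:R * (D + eta / 3) =
  (Num.sqrt d.-1%:R * Num.sqrt d%:R) * ((3 * A + 1) / 2 * l).
  by rewrite /A /l; field; rewrite !gt_eqF.
have A3 : 0 <= (3 * A + 1) / 2 <= 2 * A by have := A1; lra.
rewrite -[leRHS]mulrA; apply: ler_pM => //.
- by rewrite mulr_ge0 ?(andP A3).1 ?(ltW l0).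
- by rewrite ler_wpM2r ?(andP A3).2 ?(ltW l0).
Qed.

(** On every ball of the cover this is at least the bound for second differences
    given by the centre of that ball. *)
Definition covering_function : borelRV R d -> R := fun x =>
  \sum_(z | near_X z) 2 * axis_diff f b (c z) * \1_(cball (c z) (eta / 3)) x.

Let subf' x : exists p, subgradient f x p.
Proof. by have [p _ ?] := subf x; exists p. Qed.

Lemma covering_function_ge0 x : 0 <= covering_function x.
Proof. by apply: sumr_ge0 => z _; rewrite !mulr_ge0// axis_diff_ge0. Qed.

Lemma measurable_covering_function : measurable_fun setT covering_function.
Proof.
rewrite /covering_function; under eq_fun do rewrite -big_filter.
apply: measurable_sum => z; apply: measurable_funM => //.
by apply: measurable_indic; exact: measurable_cball.
Qed.

Lemma second_diff_le_covering_function x u : X x -> enorm u <= 1 ->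
  second_diff f x (eta *: u) <= covering_function x.
Proof.
move=> Xx u1; have [z xz] := lattice_cover Xx.
have nz : near_X z by apply/asboolP; exists x.
apply: (@le_trans _ _ (2 * axis_diff f b (c z))).
  apply: second_diff_le_axis_diff => //; first exact: ltW.
  by rewrite bE ler_wpM2l ?sqrtr_ge0// lerD2r.
rewrite /covering_function (bigD1 z)//= indicE mem_set// mulr1 lerDl.
by apply: sumr_ge0 => z' _; rewrite !mulr_ge0// axis_diff_ge0.
Qed.

(** A bound on [e] by hand: [expR (- (1 / 6)) >= 5 / 6], and [(6 / 5) ^+ 6 <= 3]. *)
Lemma expR1_le3 : expR 1 <= 3 :> R.
Proof.
have h : 5 / 6 <= expR (- (1 / 6)) :> R.
  by apply: le_trans (expR_ge1Dx _); lra.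
have : (5 / 6) ^+ 6 <= expR (- 1) :> R.
  have -> : -1 = 6%:R * - (1 / 6) :> R by lra.
  by rewrite expRM_natl lerXn2r ?nnegrE ?expR_ge0.
have e0 : 0 < expR (-1) :> R := expR_gt0 _.
have -> : expR 1 = (expR (-1))^-1 :> R by rewrite expRN invrK.
move=> h6; rewrite -[leRHS]invrK lef_pV2 ?posrE ?invr_gt0//; apply: le_trans h6; lra.
Qed.

(** The parameter [lam = 1 / (2 A)] of [sum_axis_diff_lattice] makes the exponent
    [lam * T] equal to [d - 1 / 2]. *)
Lemma sum_axis_diff_near_X : \sum_(z | near_X z) axis_diff f b (c z) <=
  d%:R * (d.*2%:R * (b * L)) * (3 ^+ d.-1 * Num.sqrt 3) * (5 * A) ^+ d.-1.
Proof.
have A0 : 0 < A := lt_le_trans ltr01 A1.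
have lam0 : 0 < (2 * A)^-1 by rewrite invr_gt0 mulr_gt0.
apply: le_trans (sum_axis_diff_lattice subf diamY d.*2 x0 (ltW l0) lam0 L0 (fun z j => @near_X_l1 z j)) _.
have B0 : 0 <= d%:R * (d.*2%:R * (b * L)) by rewrite !mulr_ge0// ltW.
rewrite -/b; apply: ler_pM.
- by rewrite mulr_ge0// expR_ge0.
- by rewrite exprn_ge0// addr_ge0// divr_ge0// ltW.
- rewrite ler_wpM2l//.
  have -> : (2 * A)^-1 * ((d%:R - 1 / 2) * (2 * A)) = d.-1%:R * 1 + 1 / 2.
    by rewrite d1; field; rewrite gt_eqF.
  rewrite expRD expRM_natl; apply: ler_pM; rewrite ?exprn_ge0 ?expR_ge0//.
    by rewrite lerXn2r ?nnegrE ?expR_ge0// expR1_le3.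
  rewrite -(@ler_pXn2r _ 2) ?nnegrE ?expR_ge0 ?sqrtr_ge0// sqr_sqrtr// -expRM_natl.
  by rewrite mulrC divfK// expR1_le3.
- have A20 : 0 <= 1 + 2 / (2 * A)^-1 <= 5 * A by rewrite invrK; have := A1; lra.
  by rewrite lerXn2r ?nnegrE ?(andP A20).1 ?(andP A20).2// mulr_ge0// ltW.
Qed.

Lemma integral_covering_function_le : (\int[rho]_x (covering_function x)%:E <=
  (eta * (c_const R d * M * L * D ^+ d.-1 * eta `^ theta))%:E)%E.
Proof.
have A0 : 0 < A := lt_le_trans ltr01 A1.
have D0 : 0 < D := lt_le_trans eta0 etaD.
pose p : R := d%:R - 1 + theta.
have r0 : 0 < eta / 3 by rewrite divr_gt0.
apply: (@le_trans _ _ (\sum_(z | near_X z) (2 * axis_diff f b (c z) * (M * (eta / 3) `^ p))%:E)%E).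
  under eq_integral do rewrite -sumEFin -big_filter.
  rewrite -[leRHS]big_filter ge0_integral_sum//; last 2 first.
  - move=> z; apply/measurable_EFinP; apply: measurable_funM => //.
    by apply: measurable_indic; exact: measurable_cball.
  - by move=> z x _; rewrite lee_fin !mulr_ge0// axis_diff_ge0.
  apply: lee_sum => z _; under eq_integral do rewrite EFinM.
  rewrite ge0_integralZl//=; last 2 first.
  - by apply/measurable_EFinP; apply: measurable_indic; exact: measurable_cball.
  - by rewrite lee_fin mulr_ge0// axis_diff_ge0.
  rewrite integral_indic//; last exact: measurable_cball.
  rewrite setIT [leRHS]EFinM lee_wpmul2l ?cball_growth//.
  by rewrite lee_fin mulr_ge0// axis_diff_ge0.
rewrite sumEFin lee_fin -mulr_suml -mulr_sumr.
have p1 : (eta / 3) `^ p <= (eta / 3) ^+ d.-1 * eta `^ theta.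
  rewrite /p powRD; last by rewrite (gt_eqF r0) implybT.
  rewrite -d1 powR_mulrn ?ler_wpM2l ?exprn_ge0 ?(ltW r0)//.
  by rewrite ge0_ler_powR ?(ltW theta0)// ?nnegrE ?(ltW r0) ?(ltW eta0)// ler_pdivrMr// ler_peMr// ?(ltW eta0)// ler1n.
apply: (@le_trans _ _ (2 * (d%:R * (d.*2%:R * (b * L)) * (3 ^+ d.-1 * Num.sqrt 3) * (5 * A) ^+ d.-1)
   * (M * ((eta / 3) ^+ d.-1 * eta `^ theta)))).
  rewrite ler_pM ?mulr_ge0 ?powR_ge0 ?(ltW M0)//.
  - by apply: sumr_ge0 => z _; rewrite axis_diff_ge0.
  - by rewrite ler_wpM2l// sum_axis_diff_near_X.
  - by rewrite ler_wpM2l ?(ltW M0).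
have := covering_const_le (R := R) d0.
set C := c_const R d; move=> Cle.
have s3 : Num.sqrt 3 ^+ 2 = 3 :> R by rewrite sqr_sqrtr.
have s30 : 0 < Num.sqrt 3 :> R by rewrite sqrtr_gt0.
set K := 16 / _ * _ * _ * _ in Cle.
have KE : K = 16 / 3 * Num.sqrt 3 * d%:R ^+ 2 * Num.sqrt d%:R * 5 ^+ d.-1.
  have -> : 16 / 3 * Num.sqrt 3 = 16 / Num.sqrt 3 :> R.
    by rewrite -[X in _ / X * _]s3; field; rewrite gt_eqF.
  by [].
have -> : 2 * (d%:R * (d.*2%:R * (b * L)) * (3 ^+ d.-1 * Num.sqrt 3) * (5 * A) ^+ d.-1)
   * (M * ((eta / 3) ^+ d.-1 * eta `^ theta)) = eta * (K * M * L * D ^+ d.-1 * eta `^ theta).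
  have -> : D = A * eta by rewrite /A divfK ?gt_eqF.
  rewrite KE /b /l !exprMn !exprVn -muln2 natrM; set s := Num.sqrt d%:R; rewrite -sd2 -/s.
  have e3 : 3 ^+ d.-1 != 0 :> R by rewrite expf_neq0.
  by field; rewrite e3 expf_neq0 ?gt_eqF.
by rewrite !(ler_wpM2l (ltW eta0), ler_wpM2r)// ?powR_ge0 ?exprn_ge0 ?(ltW M0) ?(ltW D0).
Qed.

Theorem exists_covering_function : exists S : borelRV R d -> R,
  [/\ measurable_fun setT S, forall x, 0 <= S x,
      forall x u, X x -> enorm u <= 1 -> second_diff f x (eta *: u) <= S x &
      (\int[rho]_x (S x)%:E <=
        (eta * (c_const R d * M * L * D ^+ d.-1 * eta `^ theta))%:E)%E].
Proof.
exists covering_function; split.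
- exact: measurable_covering_function.
- exact: covering_function_ge0.
- exact: second_diff_le_covering_function.
- exact: integral_covering_function_le.
Qed.

End Covering.

(** * Coupling a measure with itself by a cyclic exchange of mass *)

Section RestrictedMeasure.
Context d (T : measurableType d) (R : realType).
Implicit Types (m : {measure set T -> \bar R}) (D : set T) (h : T -> \bar R).
Local Open Scope ereal_scope.

Lemma ge0_integral_mrestr m D (mD : measurable D) h :
  measurable_fun setT h -> (forall x, 0 <= h x) ->
  \int[mrestr m mD]_x h x = \int[m]_(x in D) h x.
Proof.
move=> mh h0; rewrite (@ge0_negligible_integral _ _ _ _ setT (~` D))//=; last 2 first.
- exact: measurableC.
- by rewrite /mrestr setICl measure0.
rewrite setTD setCK; apply: eq_measure_integral => A mA AD.
by rewrite /= /mrestr setIidl.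
Qed.

Lemma ge0_integral_le_on m D (A : R) h : measurable D -> m (~` D) = 0 ->
  measurable_fun setT h -> (forall x, 0 <= h x) -> (forall x, D x -> h x <= A%:E) ->
  \int[m]_x h x <= A%:E * m D.
Proof.
move=> mD mD0 mh h0 hA.
rewrite (@ge0_negligible_integral _ _ _ _ setT (~` D))//; last exact: measurableC.
rewrite setTD setCK -integral_cst//; apply: ge0_le_integral_nomeas => x Dx //.
exact: hA.
Qed.

End RestrictedMeasure.

Section Swap.
Context {d} {T : measurableType d} {R : realType} (rho : probability T R).
Variables (E : nat -> set T) (mE : forall k, measurable (E k)).
Variables (m : nat) (t : R) (h : T * T -> \bar R).

Let w k : R := fine (rho (E k)).
Hypothesis E0 : forall k, (0 < rho (E k))%E.
Hypothesis t0 : 0 < t.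
Hypothesis tw : forall k, (k <= m)%N -> t <= w k.

Definition cyc_succ (k : nat) : nat := if k == m then 0%N else k.+1.

Lemma sum_cyc_succ (V : nmodType) (F : nat -> V) :
  \sum_(k < m.+1) F (cyc_succ k) = \sum_(k < m.+1) F k.
Proof.
rewrite big_ord_recr big_ord_recl /= addrC /cyc_succ eqxx; congr (_ + _).
by apply: eq_bigr => k _; rewrite (ltn_eqF (ltn_ord k)).
Qed.

Definition diagonal (x : T) : T * T := (x, x).

Lemma measurable_diagonal : measurable_fun setT diagonal.
Proof. by apply: measurable_fun_pair; exact: measurable_id. Qed.

Let diag_restr D (mD : measurable D) : {measure set (T * T) -> \bar R} :=
  measure_function_pushforward__canonical__measure_function_Measure
    (mrestr rho mD) measurable_diagonal.

(** The identity coupling of [rho], except that the mass [t] starting in [E k] is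
    sent to the next set [E (cyc_succ k)] by an independent coupling. *)
Definition swap_piece (k : nat) : {measure set (T * T) -> \bar R} :=
  measure_add (diag_restr (measurableC (mE k)))
   (measure_add (mscale (`|1 - t / w k|)%:nng (diag_restr (mE k)))
     (mscale (`|t / (w k * w (cyc_succ k))|)%:nng
        (mrestr rho (mE k) \x mrestr rho (mE (cyc_succ k)))%E)).

(** Averaging over the cycle restores the second marginal: for every [k] the set
    [E k] gains in the piece before it what it loses in its own. *)
Definition swap : {measure set (T * T) -> \bar R} :=
  mscale (m.+1%:R^-1)%:nng (msum swap_piece m.+1).

Let r (k : nat) (A : set T) : R := fine (rho (A `&` E k)).

Let rE k A : measurable A -> rho (A `&` E k) = (r k A)%:E.
Proof. by move=> mA; rewrite /r fineK//; apply: fin_num_measure; exact: measurableI. Qed.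

Let rC k A : measurable A -> rho (A `&` ~` E k) = (fine (rho A) - r k A)%:E.
Proof.
move=> mA; have -> : (rho A = rho (A `&` ~` E k) + rho (A `&` E k))%E.
  by rewrite -setDE; exact: measureDI.
have f1 : rho (A `&` ~` E k) \is a fin_num.
  by apply: fin_num_measure; apply: measurableI => //; exact: measurableC.
by rewrite rE// -(fineK f1) -EFinD/= addrK.
Qed.

Let w0 k : 0 < w k.
Proof. by rewrite fine_gt0// E0/= ltey_eq fin_num_measure. Qed.

Let wE k : rho (E k) = (w k)%:E.
Proof. by rewrite fineK// fin_num_measure. Qed.

Let a0 k : (k <= m)%N -> 0 <= 1 - t / w k.
Proof. by move=> /tw tk; rewrite subr_ge0 ler_pdivrMr// mul1r. Qed.

Let b0 k : 0 <= t / (w k * w (cyc_succ k)).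
Proof. by rewrite divr_ge0 ?mulr_ge0 ?ltW. Qed.

Lemma swap_pieceE k B : (k <= m)%N -> swap_piece k B =
  (rho (diagonal @^-1` B `&` ~` E k) +
   ((1 - t / w k)%:E * rho (diagonal @^-1` B `&` E k) +
    (t / (w k * w (cyc_succ k)))%:E *
      (mrestr rho (mE k) \x mrestr rho (mE (cyc_succ k))) B))%E.
Proof.
move=> km; etransitivity; first exact: measure_addE.
congr (_ + _)%E; etransitivity; first exact: measure_addE.
transitivity (`|1 - t / w k|%:E * rho (diagonal @^-1` B `&` E k) +
    `|t / (w k * w (cyc_succ k))|%:E *
      (mrestr rho (mE k) \x mrestr rho (mE (cyc_succ k))) B)%E; first by [].
by rewrite !ger0_norm ?a0.
Qed.

Let productE k j A B : measurable A -> measurable B ->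
  (mrestr rho (mE k) \x mrestr rho (mE j))%E (A `*` B) = (r k A * r j B)%:E.
Proof.
move=> mA mB; transitivity (rho (A `&` E k) * rho (B `&` E j))%E.
  exact: product_measure1E.
by rewrite !rE// EFinM.
Qed.

Let rT k : r k setT = w k. Proof. by rewrite /r setTI. Qed.

Lemma swap_piece_fst k A : (k <= m)%N -> measurable A ->
  swap_piece k (A `*` setT) = rho A.
Proof.
move=> km mA; rewrite swap_pieceE// productE// rT.
rewrite (_ : diagonal @^-1` (A `*` setT) = A); last by apply/seteqP; split => x // [].
rewrite rC// rE// -!EFinM -!EFinD -[RHS]fineK ?fin_num_measure//.
by congr (_%:E); field; rewrite !gt_eqF.
Qed.

Lemma swap_piece_snd k A : (k <= m)%N -> measurable A ->
  swap_piece k (setT `*` A) =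
  (fine (rho A) - t / w k * r k A + t / w (cyc_succ k) * r (cyc_succ k) A)%:E.
Proof.
move=> km mA; rewrite swap_pieceE// productE// rT.
rewrite (_ : diagonal @^-1` (setT `*` A) = A); last by apply/seteqP; split => x // [].
rewrite rC// !rE// -!EFinM -!EFinD.
by congr (_%:E); field; rewrite !gt_eqF.
Qed.

Let swapE B : swap B = (m.+1%:R^-1%:E * \sum_(k < m.+1) swap_piece k B)%E.
Proof. by []. Qed.

Lemma swap_fst A : measurable A -> swap (A `*` setT) = rho A.
Proof.
move=> mA; rewrite swapE.
rewrite (eq_bigr (fun=> (fine (rho A))%:E)); last first.
  by move=> k _; rewrite swap_piece_fst ?fineK ?fin_num_measure// -ltnS.
rewrite sumEFin sumr_const card_ord -EFinM -[RHS]fineK ?fin_num_measure//.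
by congr (_%:E); rewrite -[fine _ *+ _]mulr_natl mulKf.
Qed.

Lemma swap_snd A : measurable A -> swap (setT `*` A) = rho A.
Proof.
move=> mA; rewrite swapE.
under eq_bigr => k _ do rewrite swap_piece_snd// -1?ltnS//.
rewrite sumEFin -EFinM -[RHS]fineK ?fin_num_measure//; congr (_%:E).
rewrite big_split/= (sum_cyc_succ (fun k => t / w k * r k A)) big_split/= sumrN subrK.
by rewrite sumr_const card_ord -[fine _ *+ _]mulr_natl mulKf.
Qed.

Hypotheses (mh : measurable_fun setT h) (h0 : forall z, (0 <= h z)%E).

(** The mass [t] pays at most [A] after the exchange, and paid at least [B]
    before. *)
Lemma integral_swap_piece_le k (I A B : R) : (k <= m)%N ->
  (\int[rho]_x h (x, x) = I%:E)%E ->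
  (forall x, E k x -> B%:E <= h (x, x))%E ->
  (forall x y, E k x -> E (cyc_succ k) y -> h (x, y) <= A%:E)%E ->
  (\int[swap_piece k]_z h z <= (I + t * (A - B))%:E)%E.
Proof.
move=> km hI hB hA; pose J := (\int[rho]_(x in E k) h (x, x))%E.
have mhd : measurable_fun setT (h \o diagonal).
  exact: measurableT_comp measurable_diagonal.
have mEC : measurable (~` E k) by exact: measurableC.
have J0 : (0 <= J)%E by exact: integral_ge0.
have IE : (\int[rho]_(x in ~` E k) h (x, x) + J = I%:E)%E.
  rewrite addeC -hI -[in RHS](setUv (E k)) ge0_integral_setU//.
  - by rewrite setUv.
  - by apply/disj_setPS => x [].
have Jfin : J \is a fin_num.
  rewrite ge0_fin_numE//; apply: (@le_lt_trans _ _ I%:E); last exact: ltry.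
  by rewrite -IE leeDr// integral_ge0.
have BJ : B * w k <= fine J.
  have [B0|B0] := leP 0 B; last first.
    by apply: (@le_trans _ _ 0); rewrite ?fine_ge0// pmulr_lle0 ?ltW.
  rewrite -lee_fin (fineK Jfin) EFinM -wE -integral_cst//.
  by apply: ge0_le_integral_nomeas => x Ex; [rewrite lee_fin|exact: hB].
have prodle : (\int[mrestr rho (mE k) \x mrestr rho (mE (cyc_succ k))]_z h z
    <= (A * (w k * w (cyc_succ k)))%:E)%E.
  have mEE : measurable (E k `*` E (cyc_succ k)) by exact: measurableX.
  apply: le_trans (ge0_integral_le_on mEE _ mh h0 (A := A) _) _.
  - have : (mrestr rho (mE k) \x mrestr rho (mE (cyc_succ k)))%E.-negligible
        ((~` E k `*` setT) `|` (setT `*` ~` E (cyc_succ k))).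
      have mXC : measurable (~` E k `*` [set: T]) by apply: measurableX => //; exact: measurableC.
      have mCX : measurable ([set: T] `*` ~` E (cyc_succ k)).
        by apply: measurableX => //; exact: measurableC.
      apply: negligibleU; apply/negligibleP => //.
      + by apply: (etrans (productE k (cyc_succ k) (measurableC (mE k)) measurableT)); rewrite /r setICl measure0 mul0r.
      + by apply: (etrans (productE k (cyc_succ k) measurableT (measurableC (mE (cyc_succ k))))); rewrite /r setICl measure0 mulr0.
    move=> N0; apply/negligibleP; first exact: measurableC.
    by apply: negligibleS N0 => -[x y] /= /not_andP[Nx|Ny]; [left|right].
  - by move=> -[x y] [/= Ex Ey]; exact: hA.
  - rewrite EFinM le_eqVlt; apply/orP; left; apply/eqP; congr (_ * _)%E.
    apply: (etrans (productE k (cyc_succ k) (mE k) (mE (cyc_succ k)))).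
    by rewrite /r !setIid.
rewrite /swap_piece ge0_integral_measure_add// ge0_integral_measure_add//.
rewrite !ge0_integral_mscale//= !ge0_integral_pushforward//=; try exact: measurable_diagonal.
rewrite !preimage_setT !ge0_integral_mrestr//= -[(\int[rho]_(x in E k) h (diagonal x))%E]/J.
rewrite !ger0_norm ?a0 ?b0//.
have [j JE] : exists j, J = j%:E by exists (fine J); rewrite fineK.
move: BJ; rewrite JE /= => BJ.
have -> : (\int[rho]_(x in ~` E k) h (diagonal x) = (I - j)%:E)%E.
  by rewrite EFinB -JE -IE addeK.
apply: le_trans (leeD2l _ (leeD2l _ (lee_wpmul2l _ prodle))) _.
  by rewrite lee_fin b0.
rewrite -!EFinM -!EFinD lee_fin.
have -> : t / (w k * w (cyc_succ k)) * (A * (w k * w (cyc_succ k))) = t * A.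
  by field; rewrite !gt_eqF.
have : t / w k * (B * w k) <= t / w k * j by rewrite ler_wpM2l// divr_ge0 ?ltW.
have -> : t / w k * (B * w k) = t * B by field; rewrite gt_eqF.
lra.
Qed.

Lemma integral_swap_le (I : R) (A B : nat -> R) :
  (\int[rho]_x h (x, x) = I%:E)%E ->
  (forall k x, (k <= m)%N -> E k x -> ((B k)%:E <= h (x, x))%E) ->
  (forall k x y, (k <= m)%N -> E k x -> E (cyc_succ k) y -> (h (x, y) <= (A k)%:E)%E) ->
  (\int[swap]_z h z <= (I + t / m.+1%:R * \sum_(k < m.+1) (A k - B k))%:E)%E.
Proof.
move=> hI hB hA; rewrite /swap ge0_integral_mscale// ge0_integral_measure_sum//=.
apply: (@le_trans _ _ (m.+1%:R^-1%:E * \sum_(k < m.+1) (I + t * (A k - B k))%:E)%E).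
  rewrite lee_wpmul2l// lee_sum// => k _; have km : (k <= m)%N by rewrite -ltnS.
  by apply: integral_swap_piece_le => // [x Ex|x y Ex Ey]; [exact: hB|exact: hA].
rewrite sumEFin -EFinM lee_fin big_split/= sumr_const card_ord -mulr_sumr mulrDr.
by rewrite -[I *+ _]mulr_natl mulKf// mulrA [_^-1 * t]mulrC.
Qed.

End Swap.

(** * Cyclic monotonicity of optimal maps *)

Section GenericPoints.
Context {R : realType} {d : nat}.

Lemma rat_dense_enorm (x : 'rV[R]_d) (e : R) : 0 < e ->
  exists q : 'rV[rat]_d, enorm (x - map_mx ratr q) < e.
Proof.
move=> e0; pose c := e / (d%:R + 1).
have c0 : 0 < c by rewrite divr_gt0// ltr_wpDl.
have qP i : exists q : rat, `|x 0 i - ratr q| <= c.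
  have /rat_in_itvoo[q] : x 0 i - c < x 0 i + c by lra.
  rewrite in_itv/= => /andP[q1 q2]; exists q; rewrite ler_norml; lra.
exists (\row_i projT1 (cid (qP i))).
apply: le_lt_trans (enorm_le_sup_norm _) _.
apply: (@le_lt_trans _ _ (d%:R * c)).
  rewrite ler_wpM2l// /Num.norm/= mx_normrE; apply: bigmax_le => [|[i j] _]; first exact: ltW.
  by rewrite ord1 !mxE; exact: (projT2 (cid (qP j))).
by rewrite /c mulrCA -[ltRHS]mulr1 ltr_pM2l// ltr_pdivrMr ?ltr_wpDl// mul1r ltrDl.
Qed.

Variables (rho : probability (borelRV R d) R) (T : borelRV R d -> borelRV R d).
Hypothesis mT : measurable_fun setT T.

Let box (i : 'rV[rat]_d * 'rV[rat]_d * nat) : set (borelRV R d) :=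
  eball (map_mx ratr i.1.1) (i.2.+1%:R^-1) `&` T @^-1` eball (map_mx ratr i.1.2) (i.2.+1%:R^-1).

Let measurable_box i : measurable (box i).
Proof.
apply: measurableI; first exact: measurable_eball.
by rewrite -[X in measurable X]setTI; apply: mT => //; exact: measurable_eball.
Qed.

(** The rational boxes of measure zero form a countable, hence null, family. Every
    other [x] is generic: [(x, T x)] is in the support of the law of [(x, T x)]. *)
Lemma generic_points : exists S : set (borelRV R d),
  [/\ measurable S, rho S = 1%E &
   forall x e, S x -> 0 < e -> exists E : set (borelRV R d),
     [/\ measurable E, (0 < rho E)%E &
      forall y, E y -> enorm (y - x : 'rV[R]_d) < e /\ enorm (T y - T x : 'rV[R]_d) < e]].
Proof.
pose F k := if unpickle k is Some i then (if rho (box i) == 0 then box i else set0) else set0.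
have mF k : measurable (F k).
  by rewrite /F; case: unpickle => // i; case: ifP.
have F0 k : rho (F k) = 0.
  by rewrite /F; case: unpickle => [i|]; rewrite ?measure0//; case: ifPn => [/eqP//|]; rewrite measure0.
have mU : measurable (\bigcup_k F k) by exact: bigcupT_measurable.
have U0 : rho (\bigcup_k F k) = 0.
  apply: measure_negligible => //; apply: negligible_bigcup => k.
  by apply/negligibleP; [exact: mF|exact: F0].
exists (~` \bigcup_k F k); split; first exact: measurableC.
  by rewrite probability_setC// U0 sube0.
move=> x e Sx e0.
have [n ne] : exists n, n.+1%:R^-1 < e / 2.
  have e20 : 0 < e / 2 by rewrite divr_gt0.
  by exists (Num.truncn (e / 2)^-1); rewrite invf_plt ?posrE// truncnS_gt.
have n0 : 0 < n.+1%:R^-1 :> R by rewrite invr_gt0.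
have [a xa] := rat_dense_enorm x n0.
have [b xb] := rat_dense_enorm (T x) n0.
have Bx : box (a, b, n) x by split; rewrite /= /eball/=.
exists (box (a, b, n)); split => //.
- rewrite lt0e measure_ge0 andbT; apply/negP => B0; apply: Sx.
  by exists (pickle (a, b, n)) => //; rewrite /F pickleK B0.
- move=> y [/= ya yb]; move: ya yb; rewrite /eball/= => ya yb; split.
    apply: le_lt_trans (enorm_triangle (map_mx ratr a) _ _) _; rewrite (enormB _ x) [e]splitr.
    by apply: ltrD; [exact: lt_trans ya ne|exact: lt_trans xa ne].
  apply: le_lt_trans (enorm_triangle (map_mx ratr b) _ _) _; rewrite (enormB _ (T x)) [e]splitr.
  by apply: ltrD; [exact: lt_trans yb ne|exact: lt_trans xb ne].
Qed.

End GenericPoints.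

Section CyclicMonotone.
Context {R : realType} {d : nat}.
Variables (rho mu : probability (borelRV R d) R) (T : borelRV R d -> borelRV R d).

Definition sqdist (z : borelRV R d * borelRV R d) : R := enorm (z.1 - z.2 : 'rV[R]_d) ^+ 2.

Lemma measurable_sqdist : measurable_fun setT sqdist.
Proof.
rewrite (_ : sqdist = fun z => \sum_(i < d) ((z.1 : 'rV[R]_d) 0 i - (z.2 : 'rV[R]_d) 0 i) ^+ 2); last first.
  apply/funext => z; rewrite /sqdist enorm_sqr; apply: eq_bigr => i _.
  by rewrite !mxE expr2.
apply: measurable_sum => i; apply: measurable_funX; apply: measurable_funB.
  exact: measurableT_comp (measurable_coord i) measurable_fst.
exact: measurableT_comp (measurable_coord i) measurable_snd.
Qed.

Hypothesis optT : is_optimal_map rho mu T.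

Let mT : measurable_fun setT T. Proof. by case: optT. Qed.

Lemma optimal_map_pushforward A : measurable A -> mu A = rho (T @^-1` A).
Proof.
case: optT => _ [gamma [cg _] gE] mA; have [_ <-] := cg A mA.
rewrite gE; last exact: measurableX.
by congr (rho _); apply/seteqP; split => x //= [].
Qed.

(** A coupling of [rho] with itself is a competitor of the optimal map, after
    applying [T] to the second coordinate. *)
Lemma optimal_map_self_coupling
    (pi : {measure set (borelRV R d * borelRV R d)%type -> \bar R}) :
  (forall A, measurable A -> pi (A `*` setT) = rho A) ->
  (forall A, measurable A -> pi (setT `*` A) = rho A) ->
  (\int[rho]_x (sqdist (x, T x))%:E <= \int[pi]_z (sqdist (z.1, T z.2))%:E)%E.
Proof.
move=> pi1 pi2.
have mG : measurable_fun setT (fun x : borelRV R d => (x, T x)).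
  by apply: measurable_fun_pair.
have mH : measurable_fun setT (fun z : borelRV R d * borelRV R d => (z.1, T z.2)).
  by apply: measurable_fun_pair => //; exact: measurableT_comp mT measurable_snd.
have msq : measurable_fun setT (EFin \o sqdist) by apply/measurable_EFinP; exact: measurable_sqdist.
pose gam : {measure set (borelRV R d * borelRV R d)%type -> \bar R} :=
  measure_function_pushforward__canonical__measure_function_Measure pi mH.
have gam1 : gam setT = 1%E.
  have := pi1 setT measurableT; rewrite setXTT probability_setT => <-.
  by congr (pi _).
case: optT => _ [gamma [cg og] gE].
pose gam' : probability (borelRV R d * borelRV R d)%type R := mnormalize gam gamma.
have gam'E A : gam' A = pi ((fun z : borelRV R d * borelRV R d => (z.1, T z.2)) @^-1` A).
  by rewrite /gam' /= /mnormalize gam1 onee_eq0/= invr1 mule1.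
have cg' : is_coupling rho mu gam'.
  move=> A mA; split.
    rewrite gam'E (_ : _ @^-1` _ = A `*` setT) ?pi1//.
  have mTA : measurable (T @^-1` A) by rewrite -[X in measurable X]setTI; exact: mT.
  rewrite gam'E optimal_map_pushforward// (_ : _ @^-1` _ = setT `*` T @^-1` A) ?pi2//.
have := og gam' cg'; rewrite /transport_cost.
have -> : (\int[gamma]_z (enorm (z.1 - z.2 : 'rV[R]_d) ^+ 2)%:E = \int[rho]_x (sqdist (x, T x))%:E)%E.
  transitivity (\int[pushforward rho (fun x : borelRV R d => (x, T x))]_z (sqdist z)%:E)%E.
    by apply: eq_measure_integral => A mA _; exact: gE.
  by rewrite ge0_integral_pushforward//= => z _; rewrite lee_fin sqr_ge0.
move/le_trans; apply; rewrite le_eqVlt; apply/orP; left; apply/eqP.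
transitivity (\int[pushforward pi (fun z : borelRV R d * borelRV R d => (z.1, T z.2))]_z (sqdist z)%:E)%E.
  by apply: eq_measure_integral => A mA _; exact: gam'E.
by rewrite ge0_integral_pushforward//= => z _; rewrite lee_fin sqr_ge0.
Qed.

Lemma exists_lower_bound (w : nat -> R) (m : nat) : (forall k, 0 < w k) ->
  exists2 t, 0 < t & forall k, (k <= m)%N -> t <= w k.
Proof.
move=> w0; elim: m => [|m [t t0 tw]].
  by exists (w 0%N) => // k; rewrite leqn0 => /eqP ->.
exists (Num.min t (w m.+1)); first by rewrite lt_min t0 w0.
move=> k; rewrite leq_eqVlt => /orP[/eqP ->|]; first by rewrite ge_min lexx orbT.
by rewrite ltnS => /tw tk; rewrite ge_min tk.
Qed.

Lemma dist_sqr_enorm_le (x x' y y' : 'rV[R]_d) (e C : R) : 0 <= e <= 1 ->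
  enorm (x' - x) <= e -> enorm (y' - y) <= e -> enorm (x - y) <= C ->
  `|enorm (x' - y') ^+ 2 - enorm (x - y) ^+ 2| <= 4 * e * (C + 1).
Proof.
move=> /andP[e0 e1] xe ye bC; set a := enorm (x' - y'); set b := enorm (x - y).
have ab : `|a - b| <= 2 * e.
  apply: le_trans (normr_enormB_le _ _) _.
  rewrite (_ : x' - y' - (x - y) = (x' - x) - (y' - y)); last first.
    by apply/rowP => i; rewrite !mxE; ring.
  by apply: le_trans (enormD _ _) _; rewrite enormN mulr2n mulrDl mul1r lerD.
have a0 : 0 <= a := enorm_ge0 _; have b0 : 0 <= b := enorm_ge0 _.
have abC : `|a + b| <= 2 * (C + 1).
  rewrite ger0_norm ?addr_ge0//; move: ab; rewrite ler_norml => /andP[_ ab].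
  by rewrite -/b in bC; lra.
rewrite subr_sqr normrM.
have -> : 4 * e * (C + 1) = (2 * e) * (2 * (C + 1)) by lra.
exact: ler_pM.
Qed.

Hypothesis finite_cost : (\int[rho]_x (sqdist (x, T x))%:E < +oo)%E.

(** Otherwise a small mass could be exchanged cyclically between neighbourhoods of
    the points, at a lower cost: the squared norms cancel around the cycle, and
    only the inner products remain. *)
Lemma optimal_map_cyclic_monotone : exists S : set (borelRV R d),
  [/\ measurable S, rho S = 1%E &
   forall (m : nat) (p : nat -> borelRV R d), (forall k, S (p k)) ->
     \sum_(k < m.+1) dot (p k) (T (p (cyc_succ m k))) <= \sum_(k < m.+1) dot (p k) (T (p k))].
Proof.
have [S [mS S1 SP]] := generic_points rho mT.
exists S; split => // m p Sp; rewrite leNgt; apply/negP => lt_sums.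
set s1 := \sum_(k < _) dot _ _ in lt_sums; set s2 := \sum_(k < _) dot _ _ in lt_sums.
pose q k := p (cyc_succ m k).
(* Moving each point by at most [e] changes a cost by at most [delta], and the
   [2 * m.+1] such errors use up only half of the gain [2 * (s2 - s1)]. *)
pose delta := (s2 - s1) / (2 * m.+1%:R).
have delta0 : 0 < delta by rewrite divr_gt0 ?subr_gt0.
pose C : R := \sum_(k < m.+1) (enorm (p k - T (q k) : 'rV[R]_d) + enorm (p k - T (p k) : 'rV[R]_d)).
have Ck (k : 'I_m.+1) : enorm (p k - T (q k) : 'rV[R]_d) <= C /\ enorm (p k - T (p k) : 'rV[R]_d) <= C.
  have : enorm (p k - T (q k) : 'rV[R]_d) + enorm (p k - T (p k) : 'rV[R]_d) <= C.
    by rewrite /C (bigD1 k)//= lerDl sumr_ge0// => i _; rewrite addr_ge0 ?enorm_ge0.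
  have := enorm_ge0 (p k - T (q k) : 'rV[R]_d); have := enorm_ge0 (p k - T (p k) : 'rV[R]_d).
  by move=> h1 h2 h3; split; lra.
have C0 : 0 <= C by apply: sumr_ge0 => i _; rewrite addr_ge0 ?enorm_ge0.
pose e := Num.min 1 (delta / (4 * (C + 1))).
have C10 : 0 < 4 * (C + 1) by lra.
have e0 : 0 < e by rewrite lt_min ltr01 divr_gt0.
have e01 : 0 <= e <= 1 by rewrite (ltW e0) ge_min lexx.
have eC : 4 * e * (C + 1) <= delta.
  rewrite mulrAC -ler_pdivlMl// mulrC.
  by rewrite ge_min lexx orbT.
pose E k := projT1 (cid (SP (p k) e (Sp k) e0)).
have EP k : [/\ measurable (E k), (0 < rho (E k))%E &
      forall y, E k y -> enorm (y - p k : 'rV[R]_d) < e /\ enorm (T y - T (p k) : 'rV[R]_d) < e].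
  exact: (projT2 (cid (SP (p k) e (Sp k) e0))).
have mE k : measurable (E k) by case: (EP k).
have E0 k : (0 < rho (E k))%E by case: (EP k).
have [t t0 tw] : exists2 t, 0 < t & forall k, (k <= m)%N -> t <= fine (rho (E k)).
  apply: exists_lower_bound => k.
  by rewrite fine_gt0// E0/= ltey_eq fin_num_measure.
pose h (z : borelRV R d * borelRV R d) : \bar R := (sqdist (z.1, T z.2))%:E.
have mh : measurable_fun setT h.
  apply/measurable_EFinP; apply: (measurableT_comp measurable_sqdist).
  by apply: measurable_fun_pair => //; exact: measurableT_comp mT measurable_snd.
have h0 z : (0 <= h z)%E by rewrite lee_fin sqr_ge0.
have [I II] : exists I, (\int[rho]_x (sqdist (x, T x))%:E = I%:E)%E.
  exists (fine (\int[rho]_x (sqdist (x, T x))%:E)%E).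
  by rewrite fineK// ge0_fin_numE// integral_ge0// => x _; rewrite lee_fin sqr_ge0.
have swap_le := integral_swap_le mE E0 t0 tw mh h0
  (A := fun k => sqdist (p k, T (q k)) + delta) (B := fun k => sqdist (p k, T (p k)) - delta) II.
have near k x y (km : (k <= m)%N) : E k x -> E (cyc_succ m k) y ->
    sqdist (x, T y) <= sqdist (p k, T (q k)) + delta.
  move=> Ex Ey; have [_ _ /(_ _ Ex) [xp _]] := EP k.
  have [_ _ /(_ _ Ey) [_ yq]] := EP (cyc_succ m k).
  have [Cq _] := Ck (Ordinal (km : (k < m.+1)%N)).
  have := dist_sqr_enorm_le e01 (ltW xp) (ltW yq) Cq.
  rewrite ler_norml => /andP[_]; rewrite /sqdist/=; lra.
have near' k x (km : (k <= m)%N) : E k x -> sqdist (p k, T (p k)) - delta <= sqdist (x, T x).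
  move=> Ex; have [_ _ /(_ _ Ex) [xp xq]] := EP k.
  have [_ Cp] := Ck (Ordinal (km : (k < m.+1)%N)).
  have := dist_sqr_enorm_le e01 (ltW xp) (ltW xq) Cp.
  rewrite ler_norml => /andP[+ _]; rewrite /sqdist/=; lra.
have swap1 : forall A, measurable A -> swap rho mE m t (A `*` setT) = rho A by move=> A mA; exact: swap_fst.
have swap2 : forall A, measurable A -> swap rho mE m t (setT `*` A) = rho A by move=> A mA; exact: swap_snd.
have cost_le := optimal_map_self_coupling swap1 swap2.
have : (I%:E <= (I + t / m.+1%:R * \sum_(k < m.+1)
    (sqdist (p k, T (q k)) + delta - (sqdist (p k, T (p k)) - delta)))%:E)%E.
  rewrite -{1}II; apply: le_trans cost_le _; apply: swap_le.
    by move=> k x km Ex; rewrite lee_fin; exact: near'.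
  by move=> k x y km Ex Ey; rewrite lee_fin; exact: near.
rewrite lee_fin lerDl pmulr_rge0 ?divr_gt0//; apply/negP; rewrite -ltNge.
have -> : \sum_(k < m.+1) (sqdist (p k, T (q k)) + delta - (sqdist (p k, T (p k)) - delta)) =
    2 * (s1 - s2) + m.+1%:R * (2 * delta).
  rewrite (eq_bigr (fun k : 'I_m.+1 => 2 * (dot (p k) (T (p k)) - dot (p k) (T (q k))) +
    (dot (T (q k)) (T (q k)) - dot (T (p k)) (T (p k))) + 2 * delta)); last first.
    move=> k _; rewrite /sqdist/= !enorm_sqr !dotBl !dotBr.
    by rewrite (dotC (T (q k)) (p k)) (dotC (T (p k)) (p k)); lra.
  rewrite !big_split/= -mulr_sumr sumr_const card_ord -[(2 * delta) *+ _]mulr_natl.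
  rewrite !big_split/= !sumrN (sum_cyc_succ m (fun k => dot (T (p k)) (T (p k)))) subrr addr0.
  by [].
rewrite (_ : m.+1%:R * (2 * delta) = s2 - s1); first by lra.
by rewrite /delta; field; rewrite nat1r pnatr_eq0.
Qed.

End CyclicMonotone.

(** * Potentials of cyclically monotone maps *)

Section Rockafellar.
Context {R : realType} {d : nat}.
Variables (S : set 'rV[R]_d) (T : 'rV[R]_d -> 'rV[R]_d) (rX rY : R).
Hypotheses (SX : forall x, S x -> enorm x <= rX) (TY : forall x, S x -> enorm (T x) <= rY).
Hypothesis cyc : forall (m : nat) (p : nat -> 'rV[R]_d), (forall k, S (p k)) ->
  \sum_(k < m.+1) dot (p k) (T (p (cyc_succ m k))) <= \sum_(k < m.+1) dot (p k) (T (p k)).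
Variable a : 'rV[R]_d.
Hypothesis Sa : S a.

Let rX0 : 0 <= rX. Proof. by apply: le_trans (SX Sa); exact: enorm_ge0. Qed.
Let rY0 : 0 <= rY. Proof. by apply: le_trans (TY Sa); exact: enorm_ge0. Qed.

Definition chain (p : nat -> 'rV[R]_d) (n : nat) (x : 'rV[R]_d) : R :=
  dot (x - p 0%N) (T (p 0%N)) + \sum_(k < n) dot (p k - p k.+1) (T (p k.+1)).

Definition chains (x : 'rV[R]_d) : set R :=
  [set v | exists p n, [/\ forall k, S (p k), p n = a & v = chain p n x]].

(** Rockafellar's potential: a convex function that has [T x] as a subgradient at
    every [x] in [S]. *)
Definition potential (x : 'rV[R]_d) : R := sup (chains x).

(** A chain that comes back to [a] is a cycle. *)
Lemma chain_base_le0 p n : (forall k, S (p k)) -> p n = a -> chain p n a <= 0.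
Proof.
move=> Sp pn; have := cyc n Sp; rewrite big_ord_recr/= [leRHS]big_ord_recl/=.
rewrite /cyc_succ eqxx pn /chain dotBl -subr_le0.
under eq_bigr => k _ do rewrite (ltn_eqF (ltn_ord k)).
under [in X in _ -> X]eq_bigr => k _ do rewrite dotBl.
rewrite big_split/= sumrN /bump/=; under [X in _ - (_ + X)]eq_bigr => k _ do rewrite add1n.
lra.
Qed.

Lemma chains_ub x : ubound (chains x) (enorm (x - a) * rY).
Proof.
move=> _ [p [n [Sp pn ->]]].
have -> : chain p n x = chain p n a + dot (x - a) (T (p 0%N)).
  by rewrite /chain !dotBl; lra.
have := chain_base_le0 Sp pn.
have : dot (x - a) (T (p 0%N)) <= enorm (x - a) * rY.
  by apply: le_trans (dot_le_enorm _ _) _; rewrite ler_wpM2l ?enorm_ge0 ?TY.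
lra.
Qed.

Lemma potential_ge x : dot (x - a) (T a) <= potential x.
Proof.
apply: ub_le_sup; first by exists (enorm (x - a) * rY); exact: chains_ub.
by exists (fun=> a), 0%N; split => //; rewrite /chain big_ord0 addr0.
Qed.

(** A chain evaluated at [x] extends, by the link from [z] to [x], to a chain
    evaluated at [z]. *)
Lemma potential_subgradient x z : S x -> potential x + dot (z - x) (T x) <= potential z.
Proof.
move=> Sx; rewrite -lerBrDr; apply: ge_sup.
  by exists (chain (fun=> a) 0 x), (fun=> a), 0%N.
move=> _ [p [n [Sp pn ->]]]; rewrite lerBrDr; apply: ub_le_sup.
  by exists (enorm (z - a) * rY); exact: chains_ub.
exists (fun k => if k is k'.+1 then p k' else x), n.+1; split => //; first by case.
by rewrite /chain big_ord_recl/=; lra.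
Qed.

(* The conjugate is taken over the bounded set [S] only, which makes it
   Lipschitz. *)
Let conj_set (y : 'rV[R]_d) : set R := [set dot x y - potential x | x in S].

Definition dual_potential (y : 'rV[R]_d) : R := sup (conj_set y).

Let conj_set_ub y : has_ubound (conj_set y).
Proof.
exists (rX * enorm y + (rX + rX) * rY) => _ [x Sx <-].
have h1 : dot x y <= rX * enorm y.
  by apply: le_trans (dot_le_enorm _ _) _; rewrite ler_wpM2r ?enorm_ge0 ?SX.
have h2 : - dot (x - a) (T a) <= (rX + rX) * rY.
  rewrite -dotNl; apply: le_trans (dot_le_enorm _ _) _.
  rewrite enormN ler_pM ?enorm_ge0 ?TY//.
  by apply: le_trans (enormD _ _) _; rewrite enormN lerD ?SX.
have := potential_ge x; lra.
Qed.

Lemma dual_potential_lipschitz y z : dual_potential y <= dual_potential z + rX * enorm (y - z).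
Proof.
apply: ge_sup; first by exists (dot a y - potential a), a.
move=> _ [x Sx <-].
have : dot x z - potential x <= dual_potential z.
  by apply: ub_le_sup; [exact: conj_set_ub|exists x].
have : dot x (y - z) <= rX * enorm (y - z).
  by apply: le_trans (dot_le_enorm _ _) _; rewrite ler_wpM2r ?enorm_ge0 ?SX.
rewrite dotBr; lra.
Qed.

Lemma dual_potential_continuous : continuous dual_potential.
Proof.
move=> y; apply: (@lipschitz_at_continuous _ _ y _ rX) => z.
have := dual_potential_lipschitz y z; have := dual_potential_lipschitz z y.
by rewrite ler_norml (enormB z y); lra.
Qed.

(** The subgradient [T x] turns the supremum defining the conjugate at [T x] into a
    maximum at [x]. *)
Lemma dual_potential_optimal x y : S x ->
  dot x y - dual_potential y <= dot x (T x) - dual_potential (T x).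
Proof.
move=> Sx.
have : dot x y - potential x <= dual_potential y.
  by apply: ub_le_sup; [exact: conj_set_ub|exists x].
have : dual_potential (T x) <= dot x (T x) - potential x.
  apply: ge_sup; first by exists (dot a (T x) - potential a), a.
  move=> _ [z Sz <-]; have := potential_subgradient z Sx; rewrite dotBl; lra.
lra.
Qed.

End Rockafellar.

(** * Sets of full measure and almost everywhere bounds *)

Section IntegralTools.
Context d (T : measurableType d) (R : realType) (rho : probability T R).
Local Open Scope ereal_scope.

Lemma full_measure_setC (A : set T) : measurable A -> rho A = 1 -> rho (~` A) = 0.
Proof. by move=> mA A1; rewrite probability_setC// A1 subee. Qed.

Lemma full_measureI (A B : set T) :
  measurable A -> measurable B -> rho A = 1 -> rho B = 1 -> rho (A `&` B) = 1.
Proof.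
move=> mA mB A1 B1.
have AC0 := full_measure_setC mA A1; have BC0 := full_measure_setC mB B1.
rewrite -[A `&` B]setCK probability_setC; last by apply: measurableC; exact: measurableI.
rewrite setCI (_ : rho (~` A `|` ~` B) = 0) ?sube0//.
apply: measure_negligible.
  by apply: measurableU; exact: measurableC.
by apply: negligibleU; apply/negligibleP => //; exact: measurableC.
Qed.

(** The integrand [f] may fail to be measurable, so the null set outside [W] is
    handled by the majorant [+oo] there. *)
Lemma ge0_integral_le_ae (W : set T) (f g : T -> \bar R) : measurable W -> rho W = 1 ->
  measurable_fun W g -> (forall x, 0 <= f x) -> (forall x, W x -> f x <= g x) ->
  \int[rho]_x f x <= \int[rho]_(x in W) g x.
Proof.
move=> mW W1 mg f0 fg.
have g0 x : W x -> 0 <= g x by move=> Wx; exact: le_trans (f0 x) (fg x Wx).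
have mWC : measurable (~` W) by exact: measurableC.
apply: (@le_trans _ _ (\int[rho]_x ((g \_ W) x + ((cst +oo) \_ (~` W)) x))).
  apply: ge0_le_integral_nomeas => x _; first exact: f0.
  rewrite !patchE; have [xW|xW] := boolP (x \in W).
    rewrite ifF ?adde0; first by apply: fg; rewrite -inE.
    by apply/negP; rewrite inE/=; apply; rewrite -inE.
  rewrite ifT ?leey ?add0e ?leey//.
  by rewrite inE/= => Wx; move/negP: xW; apply; rewrite inE.
rewrite ge0_integralD//; last 4 first.
- by move=> x _; apply: erestrict_ge0.
- by apply/(measurable_restrictT _ _).1.
- by move=> x _; apply: erestrict_ge0 => // y _; exact: leey.
- by apply/(measurable_restrictT _ _).1 => //; exact: measurable_cst.
have WC0 : rho (~` W) = 0 by rewrite probability_setC// W1 subee.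
rewrite -!integral_mkcond integral_cst//.
by rewrite [X in _ + _ * X](_ : _ = 0)// mule0 adde0.
Qed.

(** By Markov's inequality the set where all [F n] exceed [1 / m.+1] is null, and
    countably many [m] suffice. *)
Lemma small_integrals_ae (F : nat -> T -> R) :
  (forall n, measurable_fun setT (F n)) -> (forall n x, (0 <= F n x)%R) ->
  (forall e : R, (0 < e)%R -> exists n, \int[rho]_x (F n x)%:E <= e%:E) ->
  exists G, [/\ measurable G, rho G = 1 &
    forall x (e : R), G x -> (0 < e)%R -> exists n, (F n x <= e)%R].
Proof.
move=> mF F0 Fe.
pose A m n := [set x | (m.+1%:R^-1 < F n x)%R].
have mA m n : measurable (A m n).
  pose r : R := (m.+1%:R^-1)%R.
  rewrite -[A m n]setTI (_ : A m n = F n @^-1` `]r, +oo[%classic); first exact: mF.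
  by apply/seteqP; split => x /=; rewrite in_itv/= andbT.
have markov m n : (m.+1%:R^-1)%:E * rho (A m n) <= \int[rho]_x (F n x)%:E.
  rewrite -integral_cst//; apply: (@le_trans _ _ (\int[rho]_(x in A m n) (F n x)%:E)).
    apply: ge0_le_integral_nomeas => x Ax; first by rewrite lee_fin invr_ge0.
    by move: Ax => /ltW; rewrite -lee_fin.
  apply: ge0_subset_integral => //; first exact/measurable_EFinP.
  by move=> x _; rewrite lee_fin.
pose B m := \bigcap_n A m n.
have mB m : measurable (B m) by exact: bigcapT_measurable.
have B0 m : rho (B m) = 0.
  apply/eqP; rewrite eq_le measure_ge0 andbT; apply/lee_addgt0Pr => e e0; rewrite add0e.
  have me0 : (0 < m.+1%:R^-1 * e)%R by rewrite mulr_gt0// invr_gt0.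
  have [n Fn] := Fe _ me0.
  apply: (@le_trans _ _ (rho (A m n))).
    by apply: le_measure; rewrite ?inE// => x; apply.
  rewrite -(@lee_pmul2l _ (m.+1%:R^-1)%:E)//.
  by apply: le_trans (markov m n) _; rewrite -EFinM.
have mU : measurable (\bigcup_m B m) by exact: bigcupT_measurable.
exists (~` \bigcup_m B m); split; first exact: measurableC.
  rewrite probability_setC// (_ : rho (\bigcup_m B m) = 0) ?sube0//.
  apply: measure_negligible => //; apply: negligible_bigcup => k.
  by apply/negligibleP; [exact: mB|exact: B0].
move=> x e Gx e0.
have [m me] : exists m, (m.+1%:R^-1 < e)%R.
  by exists (Num.truncn e^-1); rewrite invf_plt ?posrE// truncnS_gt.
have : ~ B m x by move=> Bx; apply: Gx; exists m.
move=> /existsNP[n]; rewrite /A/= => nA; exists n.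
by rewrite leNgt; apply/negP => /(lt_trans me); move=> h; apply: nA.
Qed.

End IntegralTools.

(** * Kantorovich duality *)

Section Duality.
Context {R : realType} {d : nat}.
Variables (X Y : set 'rV[R]_d) (rho mu : probability (borelRV R d) R).
Variable T : borelRV R d -> borelRV R d.
Hypotheses (cX : compact X) (cY : compact Y) (rhoX : rho X = 1%E) (muY : mu Y = 1%E).
Hypothesis optT : is_optimal_map rho mu T.

Let mT : measurable_fun setT T. Proof. by case: optT. Qed.
Let mX : measurable (X : set (borelRV R d)). Proof. exact: compact_measurable_borelRV. Qed.
Let mY : measurable (Y : set (borelRV R d)). Proof. exact: compact_measurable_borelRV. Qed.
Let closedY : closed Y. Proof. by apply: compact_closed cY; exact: norm_hausdorff. Qed.

Let mTY : measurable (T @^-1` Y).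
Proof. by rewrite -[X in measurable X]setTI; exact: mT. Qed.

Definition transported : set (borelRV R d) := X `&` T @^-1` Y.

Lemma measurable_transported : measurable transported.
Proof. exact: measurableI. Qed.

Lemma transported_full : rho transported = 1%E.
Proof.
apply: full_measureI => //.
by rewrite -(optimal_map_pushforward optT).
Qed.

Lemma transported_null : rho (~` transported) = 0%E.
Proof. exact: full_measure_setC measurable_transported transported_full. Qed.

Lemma finite_cost : (\int[rho]_x (sqdist (x, T x))%:E < +oo)%E.
Proof.
have [rX rX0 XrX] := compact_enorm_bounded cX.
have [rY rY0 YrY] := compact_enorm_bounded cY.
apply: (@le_lt_trans _ _ (((rX + rY) ^+ 2)%:E * rho transported)%E); last first.
  by rewrite transported_full mule1 ltry.
apply: ge0_integral_le_on.
- exact: measurable_transported.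
- exact: transported_null.
- apply/measurable_EFinP; apply: (measurableT_comp measurable_sqdist).
  exact: measurable_fun_pair.
- by move=> x; rewrite lee_fin sqr_ge0.
- move=> x [Xx Yx]; rewrite lee_fin /sqdist/= lerXn2r ?nnegrE ?enorm_ge0 ?addr_ge0 ?(ltW rX0) ?(ltW rY0)//.
  by apply: le_trans (enormD x (- T x)) _; rewrite enormN lerD ?XrX ?YrY.
Qed.

Lemma nonempty_transported : transported !=set0.
Proof.
apply/set0P/negP => /eqP h; have := transported_full; rewrite h measure0 => /eqP.
by rewrite eq_sym onee_eq0.
Qed.

Let X0 : X !=set0. Proof. by have [x [Xx _]] := nonempty_transported; exists x. Qed.
Let Y0 : Y !=set0. Proof. by have [x [_ Yx]] := nonempty_transported; exists (T x). Qed.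

Lemma legendre_continuous psi : C0 Y psi -> continuous (legendre Y psi).
Proof.
move=> cpsi; have [rY rY0 YrY] := compact_enorm_bounded cY.
have lip x z : legendre Y psi x - legendre Y psi z <= rY * enorm (x - z).
  have [p Yp fp] := legendre_subgradient cY Y0 cpsi x.
  have := fp z; have : dot (x - z) p <= rY * enorm (x - z).
    by apply: le_trans (dot_le_enorm _ _) _; rewrite mulrC ler_wpM2r ?enorm_ge0 ?YrY.
  rewrite -(opprB z x) dotNl; lra.
move=> x; apply: (@lipschitz_at_continuous _ _ x _ rY) => z.
by rewrite ler_norml; have := lip x z; have := lip z x; rewrite (enormB z x); lra.
Qed.

(** The maximal correlation of [rho] and [mu]. The domain, of full measure, is the
    one on which the integrand is known to be bounded. *)
Definition correlation : R := \int[rho]_(x in transported) dot x (T x).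

(** The defect in the Fenchel-Young inequality at [(x, T x)]. *)
Definition excess psi (x : borelRV R d) : R :=
  legendre Y psi x + psi (T x) - dot x (T x).

Lemma excess_ge0 psi x : C0 Y psi -> transported x -> 0 <= excess psi x.
Proof.
by move=> cpsi [_ Yx]; have := legendre_ge x cY cpsi Yx; rewrite /excess; lra.
Qed.

Lemma bounded_integrable (D : set (borelRV R d)) (P : probability (borelRV R d) R)
    (f : borelRV R d -> R) (K : R) :
  measurable D -> measurable_fun D f -> (forall x, D x -> `|f x| <= K) ->
  P.-integrable D (EFin \o f).
Proof.
move=> mD mf fK; apply: measurable_bounded_integrable => //.
  exact: le_lt_trans (probability_le1 _ mD) (ltry _).
exists K; split; first exact: num_real.
by move=> r Kr x Dx; apply: le_trans (fK x Dx) (ltW Kr).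
Qed.

Lemma compact_continuous_bounded (A : set 'rV[R]_d) (f : 'rV[R]_d -> R) : compact A -> {within A, continuous f} ->
  exists K, forall x, A x -> `|f x| <= K :> R.
Proof.
move=> cA cf; have /compact_bounded[r [_ rB]] := continuous_compact cf cA.
exists (`|r| + 1) => x Ax; apply: rB; last by exists x.
by rewrite ltr_pwDr ?ler_norm.
Qed.

Let mO := measurable_transported.

Lemma integrable_legendre psi : C0 Y psi ->
  rho.-integrable X (EFin \o (legendre Y psi : borelRV R d -> R)).
Proof.
move=> cpsi; have cl := legendre_continuous cpsi.
have [K XK] := compact_continuous_bounded cX (continuous_subspaceT cl).
apply: (@bounded_integrable X rho (legendre Y psi) K) => //.
by apply: measurable_funTS; exact: continuous_measurable_borelRV.
Qed.

Lemma measurable_comp_T psi : C0 Y psi ->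
  measurable_fun (T @^-1` Y) (fun x => psi (T x)).
Proof.
move=> cpsi; have mpsi := within_continuous_measurable_borelRV closedY cpsi.
rewrite -[fun x => _]/((psi : borelRV R d -> R) \o T).
apply: (measurable_comp mY _ mpsi); last exact: measurable_funTS.
by move=> _ [x Yx <-].
Qed.

Lemma integrable_comp_T psi : C0 Y psi ->
  rho.-integrable (T @^-1` Y) (EFin \o (fun x => psi (T x))).
Proof.
move=> cpsi; have [K YK] := compact_continuous_bounded cY cpsi.
apply: (@bounded_integrable _ _ _ K) => //; first exact: measurable_comp_T.
by move=> x Yx; exact: YK.
Qed.

Lemma measurable_dot_T : measurable_fun [set: borelRV R d] (fun x => dot x (T x)).
Proof.
apply: measurable_sum => i; apply: measurable_funM; first exact: measurable_coord.
exact: measurableT_comp (measurable_coord i) mT.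
Qed.

Lemma integrable_dot_T : rho.-integrable transported (EFin \o (fun x => dot x (T x))).
Proof.
have [rX rX0 XrX] := compact_enorm_bounded cX.
have [rY rY0 YrY] := compact_enorm_bounded cY.
apply: (@bounded_integrable _ _ _ (rX * rY)) => //.
  by apply: measurable_funTS; exact: measurable_dot_T.
move=> x [Xx Yx]; apply: le_trans (normr_dot_le _ _) _.
by rewrite ler_pM ?enorm_ge0 ?XrX ?YrY.
Qed.

Lemma integral_target psi : C0 Y psi ->
  (\int[mu]_(y in Y) (psi y)%:E = \int[rho]_(x in T @^-1` Y) (psi (T x))%:E)%E.
Proof.
move=> cpsi; have mpsi := within_continuous_measurable_borelRV closedY cpsi.
have mpsiY : measurable_fun setT ((EFin \o (psi : borelRV R d -> R)) \_ (Y : set (borelRV R d))).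
  by apply/(measurable_restrictT _ _).1 => //; exact/measurable_EFinP.
transitivity (\int[pushforward rho T]_(y in Y) (psi y)%:E)%E.
  by apply: eq_measure_integral => A mA _; exact: (optimal_map_pushforward optT mA).
rewrite (eq_integral ((EFin \o (psi : borelRV R d -> R)) \_ (Y : set (borelRV R d)))); last first.
  by move=> y yY; rewrite patchE yY.
rewrite integral_pushforward//.
  by apply: eq_integral => x; rewrite inE/= patchE => Yx; rewrite mem_set.
have := integrable_comp_T cpsi; apply: eq_integrable => // x.
by rewrite inE/= patchE => Yx; rewrite mem_set.
Qed.

Lemma integral_null_diff (D : set (borelRV R d)) f : measurable D -> transported `<=` D ->
  rho.-integrable D f -> (\int[rho]_(x in D) f x = \int[rho]_(x in transported) f x)%E.
Proof.
move=> mD OD fi; rewrite (@negligible_integral _ _ _ _ D (~` transported))//.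
- by rewrite setDE setCK setIidr.
- exact: measurableC.
- exact: transported_null.
Qed.

(** The integral of [psi] against [mu] is that of [psi \o T] against [rho], and all
    integrals may be taken over [transported], whose complement is null. *)
Lemma integral_excess psi : C0 Y psi ->
  (\int[rho]_(x in transported) (excess psi x)%:E =
   (kantorovich X Y rho mu psi - correlation)%:E)%E.
Proof.
move=> cpsi.
have i1 := integrable_legendre cpsi; have i2 := integrable_comp_T cpsi.
have i3 := integrable_dot_T.
have OX : transported `<=` X by move=> x [].
have OY : transported `<=` T @^-1` Y by move=> x [].
have i1' := integrableS mX mO OX i1; have i2' := integrableS mTY mO OY i2.
rewrite /kantorovich /correlation /Rintegral integral_target//.
rewrite (integral_null_diff mX OX i1) (integral_null_diff mTY OY i2).
rewrite EFinB EFinD !fineK; try exact: integrable_fin_num.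
rewrite -(integralD_EFin mO i1' i2') -integralB//; last exact: integrableD.
Qed.

Lemma excess_bound psi : C0 Y psi -> 0 <= kantorovich X Y rho mu psi - correlation.
Proof.
move=> cpsi; rewrite -lee_fin -integral_excess//.
by apply: integral_ge0 => x Ox; rewrite lee_fin excess_ge0.
Qed.

Lemma measurable_excess psi : C0 Y psi -> measurable_fun transported (excess psi).
Proof.
move=> cpsi; apply: measurable_funB.
  apply: measurable_funD.
    apply: measurable_funTS; apply: continuous_measurable_borelRV.
    exact: legendre_continuous.
  by apply: (measurable_funS mTY) (measurable_comp_T cpsi) => x [].
by apply: measurable_funTS; exact: measurable_dot_T.
Qed.

(** The potential built from the cyclically monotone graph of [T] has no defect
    along [T], so it minimises the dual functional. *)
Lemma kantorovich_minimum : is_minimum (C0 Y) (kantorovich X Y rho mu) correlation.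
Proof.
split; last by move=> psi cpsi; rewrite -subr_ge0; exact: excess_bound.
have [S [mS S1 Scyc]] := optimal_map_cyclic_monotone optT finite_cost.
pose S' := S `&` transported.
have mS' : measurable S' by exact: measurableI.
have S'1 : rho S' = 1%E by apply: full_measureI => //; exact: transported_full.
have [a Sa] : S' !=set0.
  apply/set0P/negP => /eqP h; move: S'1; rewrite h measure0 => /eqP.
  by rewrite eq_sym onee_eq0.
have [rX rX0 XrX] := compact_enorm_bounded cX.
have [rY rY0 YrY] := compact_enorm_bounded cY.
have SX x : S' x -> enorm x <= rX by move=> [_ [Xx _]]; exact: XrX.
have SY x : S' x -> enorm (T x) <= rY by move=> [_ [_ Yx]]; exact: YrY.
have cyc (m : nat) (p : nat -> 'rV[R]_d) : (forall k, S' (p k)) ->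
    \sum_(k < m.+1) dot (p k) (T (p (cyc_succ m k))) <= \sum_(k < m.+1) dot (p k) (T (p k)).
  by move=> S'p; apply: Scyc => k; have [] := S'p k.
pose psi0 := dual_potential S' T a.
have cpsi0 : C0 Y psi0.
  by apply: continuous_subspaceT; exact: (dual_potential_continuous SX SY cyc Sa).
exists psi0 => //; apply/eqP; rewrite -subr_eq0 -eqe -integral_excess//; apply/eqP.
have zero x : S' x -> excess psi0 x = 0.
  move=> Sx; have [_ Ox] := Sx; apply/eqP; rewrite eq_le excess_ge0// andbT.
  suff : legendre Y psi0 x <= dot x (T x) - psi0 (T x) by rewrite /excess; lra.
  have [y Yy [-> _]] := legendre_attained x cY Y0 cpsi0.
  exact: (dual_potential_optimal SX SY cyc Sa y Sx).
have mg : measurable_fun transported (EFin \o excess psi0).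
  by apply/measurable_EFinP; exact: measurable_excess.
rewrite (@ge0_negligible_integral _ _ _ _ transported (~` S'))//.
- rewrite setDE setCK; apply: integral0_eq => x [_ Sx]; by rewrite zero.
- exact: measurableC.
- by move=> x Ox; rewrite lee_fin excess_ge0.
- exact: full_measure_setC.
Qed.

End Duality.

(** * Choice of the scale *)

Lemma exists_small_powR (R : realType) (theta delta : R) : 0 < theta -> 0 < delta ->
  exists2 x, 0 < x & forall y, 0 <= y -> y <= x -> y `^ theta <= delta.
Proof.
move=> t0 d0; exists (delta `^ theta^-1); first exact: powR_gt0.
move=> y y0 yx; have -> : delta = (delta `^ theta^-1) `^ theta.
  by rewrite -powRrM mulVf ?gt_eqF// powRr1// ltW.
by rewrite ge0_ler_powR ?nnegrE ?powR_ge0// ltW.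
Qed.

(** Write [eps = L * D * s `^ (1 + theta)]. At the scale [eta = D * s] both terms
    are multiples of [s `^ theta]. That scale is allowed when [0 < s <= 1]; for
    larger [s] the bound [L `^ q] is enough, and for [s = 0] the scale tends to
    zero. *)
Lemma optimise_scale (R : realType) (L D C M p q theta eps v : R) :
  0 < L -> 0 < D -> 0 <= C -> 0 < M -> 1 <= q -> 0 < theta -> 0 <= eps ->
  v <= L `^ q ->
  (forall eta, 0 < eta -> eta <= D ->
     v <= L `^ (q - 1) * (eps / eta + C * M * L * D `^ p * eta `^ theta)) ->
  v <= L `^ q * (1 + C * M * D `^ (p + theta)) * (L * D) `^ (- (theta / (1 + theta)))
       * eps `^ (theta / (1 + theta)).
Proof.
move=> L0 D0 C0 M0 q1 t0 eps0 vL veta.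
have t1 : 0 < 1 + theta by rewrite addr_gt0.
have LD0 : 0 < L * D by rewrite mulr_gt0.
have K0 : 0 <= C * M * D `^ (p + theta).
  by rewrite mulr_ge0 ?powR_ge0// mulr_ge0// ltW.
pose e := eps / (L * D); have e0 : 0 <= e by rewrite divr_ge0 ?(ltW LD0).
pose r := e `^ (theta / (1 + theta)).
have -> : L `^ q * (1 + C * M * D `^ (p + theta)) * (L * D) `^ (- (theta / (1 + theta)))
    * eps `^ (theta / (1 + theta)) = L `^ q * (1 + C * M * D `^ (p + theta)) * r.
  have epsE : eps = L * D * e by rewrite /e mulrCA mulfV ?mulr1// gt_eqF.
  rewrite epsE [(L * D * e) `^ _]powRM ?(ltW LD0)// powRN -/r.
  by field; rewrite gt_eqF ?powR_gt0.
have r0 : 0 <= r := powR_ge0 _ _.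
have Lq0 : 0 <= L `^ q := powR_ge0 _ _.
have [e1|e1] := leP 1 e.
  have r1 : 1 <= r.
    have : 1 `^ (theta / (1 + theta)) <= r.
      by rewrite ge0_ler_powR ?nnegrE// divr_ge0 ?ltW.
    by rewrite powR1.
  apply: le_trans vL _; rewrite -[leRHS]mulrA ler_peMr//.
  by apply: le_trans r1 _; rewrite ler_peMl// lerDl.
have [eps00|epsn0] := eqVneq eps 0.
  have -> : r = 0 by rewrite /r /e eps00 mul0r powR0// gt_eqF// divr_gt0.
  rewrite mulr0 leNgt; apply/negP => v0.
  pose B := L `^ (q - 1) * (C * M * L * D `^ p).
  have B0 : 0 <= B by rewrite !mulr_ge0 ?powR_ge0// ltW.
  have B10 : 0 < 2 * (B + 1) by lra.
  have [x x0 xP] := exists_small_powR t0 (divr_gt0 v0 B10).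
  pose eta := Num.min x D.
  have eta0 : 0 < eta by rewrite lt_min x0.
  have := veta eta eta0; rewrite ge_min lexx orbT => /(_ isT).
  rewrite eps00 mul0r add0r mulrA -/B => vB.
  have := xP eta (ltW eta0); rewrite ge_min lexx => /(_ isT).
  rewrite ler_pdivlMr// => h.
  have : v * (2 * (B + 1)) <= B * v.
    apply: (@le_trans _ _ (B * eta `^ theta * (2 * (B + 1)))).
      by rewrite ler_wpM2r// ltW.
    by rewrite -mulrA ler_wpM2l.
  have : 0 <= B * v by rewrite mulr_ge0// ltW.
  lra.
have epos : 0 < e by rewrite divr_gt0// lt_def epsn0.
pose s := e `^ (1 + theta)^-1.
have s0 : 0 < s by exact: powR_gt0.
have s1 : s <= 1.
  have : s <= 1 `^ (1 + theta)^-1 by rewrite ge0_ler_powR ?nnegrE ?invr_ge0// ltW.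
  by rewrite powR1.
have rE : r = s `^ theta by rewrite /s -powRrM mulrC.
have eE : e = s * s `^ theta.
  rewrite -{1}(powRr1 (ltW s0)) -powRD; last by rewrite (gt_eqF s0) implybT.
  by rewrite /s -powRrM mulVf ?gt_eqF// powRr1.
have eta0 : 0 < D * s by rewrite mulr_gt0.
have := veta _ eta0; rewrite ger_pMr// s1 => /(_ isT) /le_trans; apply.
have -> : eps / (D * s) = L * r.
  have -> : eps = L * D * e by rewrite /e mulrCA mulfV ?mulr1// gt_eqF.
  by rewrite eE -rE; field; rewrite !gt_eqF.
rewrite powRM ?(ltW D0) ?(ltW s0)// -rE [D `^ (p + theta)]powRD; last by rewrite (gt_eqF D0) implybT.
rewrite -(@mulr_powRB1 _ L q) ?(ltW L0)//; last by lra.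
rewrite le_eqVlt; apply/orP; left; apply/eqP; ring.
Qed.

(** * Stability of the gradient *)

Section Stability.
Context {R : realType} {d : nat}.
Variables (q M theta : R) (X Y : set 'rV[R]_d) (rho mu : probability (borelRV R d) R).
Variable T : borelRV R d -> borelRV R d.
Hypotheses (d2 : (2 <= d)%N) (q1 : 1 <= q) (M0 : 0 < M) (theta0 : 0 < theta).
Hypotheses (cX : compact X) (cY : compact Y) (rhoX : rho X = 1%E) (muY : mu Y = 1%E).
Hypothesis growth : forall (x : 'rV[R]_d) (eta : R), 0 < eta ->
     (rho (eball x eta) <= (M * eta `^ (d%:R - 1 + theta))%:E)%E.
Hypothesis optT : is_optimal_map rho mu T.

Let D := diam X.
Let L := diam Y.
Let d0 : (0 < d)%N. Proof. exact: leq_trans d2. Qed.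
Let mX : measurable (X : set (borelRV R d)). Proof. exact: compact_measurable_borelRV. Qed.
Let O := transported X Y T.
Let mO : measurable O. Proof. exact: measurable_transported cX cY optT. Qed.
Let O1 : rho O = 1%E. Proof. exact: transported_full cX cY rhoX muY optT. Qed.

Let O0 : O !=set0. Proof. exact: nonempty_transported cX cY rhoX muY optT. Qed.
Let X0 : X !=set0. Proof. by have [x [Xx _]] := O0; exists x. Qed.
Let Y0 : Y !=set0. Proof. by have [x [_ Yx]] := O0; exists (T x). Qed.

Let L0 : 0 <= L. Proof. exact: diam_ge0. Qed.

(** Otherwise [X] is a point, whose mass the growth condition makes zero. *)
Lemma diam_gt0 : 0 < D.
Proof.
rewrite ltNge; apply/negP => D0; have [x0 Xx0] := X0.
have p0 : 0 < d%:R - 1 + theta by rewrite ltr_wpDl// subr_ge0 ler1n.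
have M2 : 0 < 1 / (2 * M) by rewrite divr_gt0// mulr_gt0.
have [r r0 rP] := exists_small_powR p0 M2.
have : (rho X <= rho (eball x0 r))%E.
  apply: le_measure; rewrite ?inE//; first exact: measurable_eball.
  move=> x Xx; rewrite /eball/=; apply: le_lt_trans r0.
  exact: le_trans (enorm_le_diam cX Xx Xx0) D0.
rewrite rhoX => /le_trans /(_ (growth x0 r0)); rewrite lee_fin; apply/negP; rewrite -ltNge.
have := rP r (ltW r0) (lexx r); rewrite ler_pdivlMr ?mulr_gt0// => h.
rewrite mulrC; lra.
Qed.

Lemma c_const_ge0 : 0 <= c_const R d.
Proof.
apply: le_trans (covering_const_le d0).
by rewrite !mulr_ge0 ?exprn_ge0 ?invr_ge0 ?sqrtr_ge0.
Qed.

Variable psi : 'rV[R]_d -> R.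
Hypothesis cpsi : C0 Y psi.
Let f := legendre Y psi.

Let subf x : exists2 p, Y p & subgradient f x p.
Proof. exact: legendre_subgradient. Qed.
Let subf' x : exists p, subgradient f x p.
Proof. by have [p _ ?] := subf x; exists p. Qed.
Let diamY p q' : Y p -> Y q' -> enorm (q' - p) <= L.
Proof. by move=> Yp Yq; exact: enorm_le_diam. Qed.

Let C := c_const R d * M * L * D ^+ d.-1.
Let C0' : 0 <= C.
Proof.
rewrite /C; move: (c_const R d) c_const_ge0 => c c0.
by rewrite !mulr_ge0 ?exprn_ge0 ?(ltW M0) ?(ltW diam_gt0).
Qed.

Let cover eta : 0 < eta -> eta <= D -> exists S : borelRV R d -> R,
  [/\ measurable_fun setT S, forall x, 0 <= S x,
      forall x u, X x -> enorm u <= 1 -> second_diff f x (eta *: u) <= S x &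
      (\int[rho]_x (S x)%:E <= (eta * (C * eta `^ theta))%:E)%E].
Proof.
move=> eta0 etaD; have [x0 Xx0] := X0.
apply: (exists_covering_function d0 M0 theta0 L0 eta0 etaD growth Xx0 _ subf diamY).
by move=> x y; exact: enorm_le_diam.
Qed.

(** Divided by [eta], the covering function has an integral that tends to zero with
    [eta]. Almost everywhere it is thus small at some scales, where it makes
    second differences small compared to [eta]. *)
Lemma gradient_subgradient_ae : exists G : set (borelRV R d),
  [/\ measurable G, rho G = 1%E &
   forall x p, G x -> subgradient f x p -> gradient f x = p].
Proof.
pose eta (n : nat) := D / n.+1%:R.
have eta0 n : 0 < eta n by rewrite divr_gt0 ?diam_gt0.
have etaD n : eta n <= D by rewrite ler_pdivrMr// ler_peMr ?(ltW diam_gt0)// ler1n.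
pose S n := projT1 (cid (cover (eta0 n) (etaD n))).
have SP n : [/\ measurable_fun setT (S n), forall x, 0 <= S n x,
      forall x u, X x -> enorm u <= 1 -> second_diff f x (eta n *: u) <= S n x &
      (\int[rho]_x (S n x)%:E <= (eta n * (C * eta n `^ theta))%:E)%E].
  exact: (projT2 (cid (cover (eta0 n) (etaD n)))).
pose F n x := (eta n)^-1 * S n x.
have mF n : measurable_fun setT (F n).
  by apply: measurable_funM => //; have [] := SP n.
have F0 n x : 0 <= F n x.
  by rewrite mulr_ge0 ?invr_ge0 ?(ltW (eta0 n))//; have [] := SP n.
have [e e0|G [mG G1 GP]] := small_integrals_ae (rho := rho) mF F0.
  have C1 : 0 < C + 1 by rewrite ltr_wpDl.
  have [x x0 xP] := exists_small_powR theta0 (divr_gt0 e0 C1).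
  pose n := Num.truncn (D / x).
  have etax : eta n <= x.
    rewrite /eta ler_pdivrMr// mulrC -ler_pdivrMr//; apply: ltW; exact: truncnS_gt.
  exists n; rewrite /F; under eq_integral do rewrite EFinM.
  have [mS S0 _ IS] := SP n.
  rewrite ge0_integralZl//=; last 3 first.
  - exact/measurable_EFinP.
  - by move=> y _; rewrite lee_fin.
  - by rewrite lee_fin invr_ge0 ltW.
  apply: le_trans (lee_wpmul2l _ IS) _; first by rewrite lee_fin invr_ge0 ltW.
  rewrite -EFinM lee_fin mulKf ?gt_eqF//.
  have := xP (eta n) (ltW (eta0 n)) etax; rewrite ler_pdivlMr// => h.
  apply: le_trans h; rewrite mulrC ler_wpM2l ?powR_ge0// lerDl//.
exists (G `&` X); split; first exact: measurableI.
  exact: full_measureI.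
move=> x p [Gx Xx] fp; apply: gradientE => // e e0.
have [n Fn] := GP x e Gx e0; exists (eta n) => // u u1.
have [_ _ Sd _] := SP n; apply: le_trans (Sd x u Xx u1) _.
by move: Fn; rewrite /F mulrC ler_pdivrMr.
Qed.

Let eps := kantorovich X Y rho mu psi - correlation X Y rho T.

Let dist (x : borelRV R d) : R := enorm (gradient f x - T x).

(** Almost everywhere the gradient is a point of [Y], and [T x] is a subgradient up
    to the error [excess Y T psi x]. *)
Lemma stability_at_scale : exists W : set (borelRV R d),
  [/\ measurable W, rho W = 1%E, W `<=` O, forall x, W x -> dist x <= L &
   forall eta, 0 < eta -> eta <= D -> forall S : borelRV R d -> R,
     (forall x u, X x -> enorm u <= 1 -> second_diff f x (eta *: u) <= S x) ->
     forall x, W x -> dist x <= (excess Y T psi x + S x) / eta].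
Proof.
have [G [mG G1 GP]] := gradient_subgradient_ae.
exists (G `&` O); split; first exact: measurableI.
- exact: full_measureI.
- by move=> x [].
- move=> x [Gx [Xx Yx]]; have [p Yp fp] := subf x.
  by rewrite /dist (GP x p Gx fp) diamY.
move=> eta eta0 etaD S Sd x [Gx [Xx Yx]]; have [p Yp fp] := subf x.
rewrite /dist (GP x p Gx fp) ler_pdivlMr// mulrC enormB.
apply: (@dist_subgradient_le _ _ f subf' x p (T x) eta) => //.
  move=> z; have := legendre_ge z cY cpsi Yx.
  by rewrite /excess -/f dotBl; lra.
by move=> u u1; exact: Sd.
Qed.

(** Bound [dist x `^ q] by [L `^ (q - 1) * dist x] and integrate the estimate at
    scale [eta]: the mean of the excess is [eps]. *)
Lemma Lnorm_stability :
  (('N[rho]_(q%:E)[(fun x => (enorm (gradient (legendre Y psi) x - T x))%:E)] `^ q)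
   <= (stability_const X Y q M theta * eps `^ (theta / (1 + theta)))%:E)%E.
Proof.
have q0 : 0 < q by exact: lt_le_trans ltr01 q1.
rewrite poweR_Lnorm ?gt_eqF//.
have [W [mW W1 WO WL Wscale]] := stability_at_scale.
have absE x : (`|(dist x)%:E| `^ q = (dist x `^ q)%:E)%E.
  by rewrite /= ger0_norm ?enorm_ge0.
pose I := (\int[rho]_x (dist x `^ q)%:E)%E.
rewrite [leLHS](_ : _ = I); last by apply: eq_integral => x _; exact: absE.
have IL : (I <= (L `^ q)%:E)%E.
  apply: (@le_trans _ _ (\int[rho]_(x in W) (cst (L `^ q)%:E) x)%E).
    apply: ge0_integral_le_ae => //.
    - by move=> x; rewrite lee_fin powR_ge0.
    - by move=> x Wx; rewrite lee_fin ge0_ler_powR ?nnegrE ?enorm_ge0 ?WL// ltW.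
  by rewrite integral_cst// [X in (_ * X)%E](_ : _ = 1%E)// mule1.
have I0 : (0 <= I)%E by apply: integral_ge0 => x _; rewrite lee_fin powR_ge0.
have Ifin : I \is a fin_num by rewrite ge0_fin_numE// (le_lt_trans IL) ?ltry.
rewrite -(fineK Ifin) lee_fin.
have eps0 : 0 <= eps by exact: excess_bound.
have [L00|Ln0] := eqVneq L 0.
  apply: (@le_trans _ _ 0).
    by rewrite -lee_fin fineK//; apply: le_trans IL _; rewrite L00 powR0 ?gt_eqF.
  rewrite /stability_const; move: (c_const R d) c_const_ge0 => c c0'.
  by rewrite !mulr_ge0 ?addr_ge0 ?powR_ge0 ?mulr_ge0 ?powR_ge0 ?(ltW M0).
have Lp : 0 < L by rewrite lt_def Ln0.
apply: (@optimise_scale _ L D (c_const R d) M (d%:R - 1) q theta eps (fine I)) => //.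
- exact: diam_gt0.
- exact: c_const_ge0.
- by rewrite -lee_fin fineK.
move=> eta eta0 etaD; rewrite -lee_fin fineK//.
have [S [mS S0 Sd IS]] := cover eta0 etaD.
pose g x := L `^ (q - 1) / eta * (excess Y T psi x + S x).
have me : measurable_fun O (excess Y T psi) by exact: (measurable_excess cX cY rhoX muY optT cpsi).
have meW : measurable_fun W (excess Y T psi) by exact: measurable_funS me.
have mSW : measurable_fun W S by exact: measurable_funTS.
have c0 : 0 <= L `^ (q - 1) / eta by rewrite divr_ge0 ?powR_ge0 ?ltW.
have ex0 x : O x -> 0 <= excess Y T psi x by exact: excess_ge0.
apply: (@le_trans _ _ (\int[rho]_(x in W) (g x)%:E)%E).
  apply: ge0_integral_le_ae => //.
  - by apply/measurable_EFinP; apply: measurable_funM => //; apply: measurable_funD.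
  - by move=> x; rewrite lee_fin powR_ge0.
  move=> x Wx; rewrite lee_fin.
  have d0x : 0 <= dist x := enorm_ge0 _.
  rewrite -(mulr_powRB1 d0x q0) /g mulrAC -mulrA mulrC.
  apply: ler_pM; rewrite ?powR_ge0//.
    by rewrite ge0_ler_powR ?nnegrE ?WL// subr_ge0.
  exact: Wscale.
under eq_integral do rewrite EFinM.
rewrite ge0_integralZl//; last 2 first.
- by apply/measurable_EFinP; apply: measurable_funD.
- by move=> x Wx; rewrite lee_fin addr_ge0// ex0//; exact: WO.
under eq_integral do rewrite EFinD.
rewrite ge0_integralD//; last 4 first.
- by move=> x Wx; rewrite lee_fin ex0//; exact: WO.
- exact/measurable_EFinP.
- by move=> x _; rewrite lee_fin.
- exact/measurable_EFinP.
have I1 : (\int[rho]_(x in W) (excess Y T psi x)%:E <= eps%:E)%E.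
  rewrite -(integral_excess cX cY rhoX muY optT cpsi).
  apply: (@ge0_subset_integral _ _ _ rho W O mW mO (fun x => (excess Y T psi x)%:E)) => //.
    exact/measurable_EFinP.
have I2 : (\int[rho]_(x in W) (S x)%:E <= (eta * (C * eta `^ theta))%:E)%E.
  apply: le_trans IS; apply: (@ge0_subset_integral _ _ _ rho W setT mW measurableT (fun x => (S x)%:E)) => //.
    exact/measurable_EFinP.
  by move=> x _; rewrite lee_fin.
apply: (@le_trans _ _ ((L `^ (q - 1) / eta)%:E * (eps%:E + (eta * (C * eta `^ theta))%:E))%E).
  by rewrite lee_wpmul2l// leeD.
rewrite -EFinD -EFinM lee_fin le_eqVlt; apply/orP; left; apply/eqP.
have -> : D `^ (d%:R - 1) = D ^+ d.-1.
  by rewrite -powR_mulrn ?(ltW diam_gt0)// -[in LHS](prednK d0) -natr1 addrK.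
by rewrite /C; field; rewrite gt_eqF.
Qed.

End Stability.

Theorem theorem4p5 (R : realType) (d : nat) (q M theta : R)
    (X Y : set 'rV[R]_d) (rho mu : probability (borelRV R d) R)
    (T : borelRV R d -> borelRV R d) :
  (2 <= d)%N -> 1 <= q -> 0 < M -> 0 < theta <= 1 ->
  compact X -> convex_set X -> compact Y -> convex_set Y ->
  rho X = 1%E -> mu Y = 1%E ->
  (forall (x : 'rV[R]_d) (eta : R), 0 < eta ->
     (rho (eball x eta) <= (M * eta `^ (d%:R - 1 + theta))%:E)%E) ->
  is_optimal_map rho mu T ->
  exists2 m : R, is_minimum (C0 Y) (kantorovich X Y rho mu) m &
    forall psi : 'rV[R]_d -> R, C0 Y psi ->
      (('N[rho]_(q%:E)[(fun x =>
           (enorm (gradient (legendre Y psi) x - T x))%:E)] `^ q)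
       <= (stability_const X Y q M theta
           * (kantorovich X Y rho mu psi - m) `^ (theta / (1 + theta)))%:E)%E.
Proof.
move=> d2 q1 M0 /andP[theta0 _] cX _ cY _ rhoX muY growth optT.
exists (correlation X Y rho T); first exact: kantorovich_minimum.
by move=> psi cpsi; exact: Lnorm_stability.
Qed.
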